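(* Let $\kappa>0$, $D_\kappa=\pi/\sqrt{\kappa}$, let $X$ be a complete CAT$(\kappa)$ space, $C\subseteq X$ a bounded closed convex subset, $T:C\to C$ a nonexpansive mapping, and let $0<M<\frac{D_\kappa}{2}$ be an upper bound on the (finite) diameter of $C$. Let $(\lambda_n)_{n\ge1}$ be a sequence in $[0,1]$ and let $\alpha:(0,\infty)\to\mathbb{Z}_+$, $\gamma:(0,\infty)\to\mathbb{Z}_+$, $\theta:\mathbb{Z}_+\to\mathbb{Z}_+$ satisfy condition ( * ) given in the context. Let $u\in C$ and let $(x_n)_{n\ge0}$ be the Halpern iteration $x_0=u$, $x_{n+1}=\lambda_{n+1}u+(1-\lambda_{n+1})Tx_n$. Then for all $\varepsilon\in(0,2)$ (with $\sin\frac{\varepsilon\sqrt\kappa}{4}\neq0$) and all $g:\mathbb{N}\to\mathbb{N}$, $$\exists N\le\Sigma(\varepsilon,g,\kappa,M,\theta,\alpha,\gamma)\ \ \forall m,n\in[N,N+g(N)]\quad d(x_n,x_m)\le\varepsilon,$$ where moreover $N=\Theta_{K_0}\left(\sin^2\frac{\varepsilon\sqrt{\kappa}}{4}\right)$ for some integer $K_0$ with $$\left\lceil\frac1{\varepsilon_0}\right\rceil\le K_0\le\widetilde{f^*}^{\,B}(0)+\left\lceil\frac1{\varepsilon_0}\right\rceil,$$ and $$\Sigma(\varepsilon,g,\kappa,M,\theta,\alpha,\gamma)=A\left(\widetilde{f^*}^{\,B}(0)+\left\lceil\frac{1}{\varepsilon_0}\right\rceil\right),$$ with the constants $\varepsilon_0,B$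 and functionals $A,\Theta_i,\widetilde{f^*}$ (depending on $\varepsilon,g,\kappa,M,\theta,\alpha,\gamma$) defined in the context.
   Context: $\mathbb{N}=\{0,1,2,\ldots\}$, $\mathbb{Z}_+=\{1,2,\ldots\}$; intervals such as $[N,N+g(N)]$ are intervals of natural numbers. For points $x,y$ of a CAT$(\kappa)$ space with $d(x,y)<D_\kappa$ and $t\in[0,1]$, $(1-t)x+ty$ denotes the unique point $z$ of the geodesic segment $[x,y]$ with $d(z,x)=t\,d(x,y)$ and $d(z,y)=(1-t)d(x,y)$. A set is convex if it contains any geodesic segment joining two of its points. $T$ is nonexpansive if $d(Tx,Ty)\le d(x,y)$ for all $x,y$. Condition ( * ) on $(\lambda_n),\alpha,\gamma,\theta$: (1) $\lambda_{n+1}\le\varepsilon$ for all $\varepsilon>0$ and all $n\ge\alpha(\varepsilon)$; (2) $\sum_{i=\gamma(\varepsilon)+1}^{\gamma(\varepsilon)+n}|\lambda_{i+1}-\lambda_i|\le\varepsilon$ for all $\varepsilon>0$ and all $n\in\mathbb{Z}_+$; (3) $\sum_{k=1}^{\theta(n)}\lambda_{k+1}\ge n$ for all $n\in\mathbb{Z}_+$. Constants and functionals (here $i,n\in\mathbb{N}$, $\delta>0$, and $\varepsilon,g$ are the given data): $$\varepsilon_0=\frac{\cos(M\sqrt{\kappa})}{36}\sin^2\frac{\varepsilon\sqrt{\kappa}}{4},\qquad B=\left\lceil\frac{M\sqrt{\kappa}\tan(M\sqrt{\kappa})}{1-\cos(\varepsilon_0)}\right\rceil,$$ $$L_i(\delta)=\frac{\cos(M\sqrt{\kappa})\,\delta}{4M\sqrt{\kappa}(i+1)},$$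 $$\chi_i(\delta)=\max\left\{\theta\left(\left\lceil\frac1{\cos(M\sqrt{\kappa})}\right\rceil\left(\gamma(L_i(\delta))+\max\left\{\left\lceil\ln\frac{1}{L_i(\delta)}\right\rceil,1\right\}\right)\right),\ \alpha(2L_i(\delta))\right\},$$ $$\chi^*_i(\delta)=\chi_i\left(\frac{\delta}{2}\cos(M\sqrt{\kappa})\right),$$ $$T(\delta)=\left\lceil\ln\left(\frac{3}{\delta}\sin^2\frac{M\sqrt{\kappa}}2\right)\right\rceil,$$ $$\Theta_i(\delta)=\theta\left(\left\lceil\frac{1}{\cos(M\sqrt{\kappa})}\right\rceil\left(\chi^*_i\left(\frac{\delta}{3}\right)-1+\max\{T(\delta),1\}\right)\right)+1,$$ $$\Delta^*_i(\delta,g)=\frac{\delta}{3\Theta_i(\delta)-3\chi^*_i\left(\frac{\delta}{3}\right)+3g(\Theta_i(\delta))},$$ $$f(i)=\max\left\{\left\lceil\frac{M\sqrt{\kappa}}{\Delta^*_i\left(\sin^2\frac{\varepsilon\sqrt{\kappa}}{4},g\right)}\right\rceil,i\right\}-i,$$ $$f^*(i)=f\left(i+\left\lceil\frac1{\varepsilon_0}\right\rceil\right)+\left\lceil\frac1{\varepsilon_0}\right\rceil,\qquad\widetilde{f^*}(i)=i+f^*(i),$$ and $\widetilde{f^*}^{\,B}$ is the $B$-fold iterate of $\widetilde{f^*}$. Further, $$\theta^+(n)=\max_{1\le i\le n}\theta(i),\qquad\Gamma(n)=\max\left\{\chi^*_i\left(\frac13\sin^2\frac{\varepsilon\sqrt{\kappa}}{4}\right):\left\lceil\frac1{\varepsilon_0}\right\rceil\le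 i\le n\right\},$$ $$S=\left\lceil\ln\left(\frac{3\sin^2\frac{M\sqrt{\kappa}}{2}}{\sin^2\frac{\varepsilon\sqrt{\kappa}}{4}}\right)\right\rceil,\qquad A(n)=\theta^+\left(\left\lceil\frac{1}{\cos(M\sqrt{\kappa})}\right\rceil\left(\Gamma(n)-1+\max\{S,1\}\right)\right)+1.$$ (The symbol $T(\delta)$ for this integer is unrelated to the mapping $T$.) *)

(* Defs.v *)
From HB Require Import structures.
From mathcomp Require Import all_boot all_order all_algebra.
From mathcomp Require Import all_classical all_reals all_analysis.

Set Implicit Arguments.
Unset Strict Implicit.
Unset Printing Implicit Defensive.

Import Order.TTheory GRing.Theory Num.Theory.

Local Open Scope classical_set_scope.
Local Open Scope ring_scope.

#[short(type="completeMetricType")]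
HB.structure Definition CompleteMetric (K : numDomainType) :=
  {T of Complete T & Metric K T}.

(* The distance [d] is a parameter because these notions are used both for a
   metricType and for the sphere below, which carries no metric structure. *)
Section Geodesics.
Context {R : realType} {T : Type} (d : T -> T -> R).

Definition is_geodesic (x y : T) (c : R -> T) : Prop :=
  [/\ c 0 = x, c (d x y) = y &
      forall s t : R, 0 <= s <= d x y -> 0 <= t <= d x y ->
        d (c s) (c t) = `|s - t|].

Definition geodesic_segment (x y : T) (S : set T) : Prop :=
  exists2 c : R -> T, is_geodesic x y c & S = c @` [set s | 0 <= s <= d x y].

Definition geodesic_triangle (v : 'I_3 -> T) (e : 'I_3 -> set T) : Prop :=
  forall i, geodesic_segment (v i) (v (ordS i)) (e i).

Definition perimeter (v : 'I_3 -> T) : R := \sum_i d (v i) (v (ordS i)).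

(* z = (1 - t) x + t y; such a z is unique when X is CAT(kappa) and
   d x y < D_kappa. *)
Definition is_convex_comb (t : R) (x y z : T) : Prop :=
  exists S, [/\ geodesic_segment x y S, S z,
    d z x = t * d x y & d z y = (1 - t) * d x y].

Definition geodesically_convex (C : set T) : Prop :=
  forall x y S, C x -> C y -> geodesic_segment x y S -> S `<=` C.

Definition diameter (C : set T) : \bar R :=
  ereal_sup [set (d p.1 p.2)%:E | p in C `*` C].

End Geodesics.

Section CAT.
Context {R : realType}.

Definition D_ (kappa : R) : R := pi / Num.sqrt kappa.

Definition dotp (u v : 'rV[R]_3) : R := (u *m v^T) 0 0.

Definition sphere : Type := {u : 'rV[R]_3 | dotp u u == 1}.

(* The distance of the model space M_kappa^2: the angular distance of the unit
   sphere scaled by 1 / sqrt kappa. *)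
Definition model_dist (kappa : R) (u v : sphere) : R :=
  acos (dotp (val u) (val v)) / Num.sqrt kappa.

(* [v'], [e'] is a comparison triangle for [v], [e], and [p'] is a comparison
   point for [p] when it lies on the corresponding side, at the same distance
   from the corresponding initial vertex. *)
Definition CAT_inequality {T : Type} (d : T -> T -> R) (kappa : R)
    (v : 'I_3 -> T) (e : 'I_3 -> set T) : Prop :=
  forall (v' : 'I_3 -> sphere) (e' : 'I_3 -> set sphere),
    geodesic_triangle (model_dist kappa) v' e' ->
    (forall i, model_dist kappa (v' i) (v' (ordS i)) = d (v i) (v (ordS i))) ->
  forall (i j : 'I_3) (p q : T) (p' q' : sphere),
    e i p -> e j q -> e' i p' -> e' j q' ->
    model_dist kappa (v' i) p' = d (v i) p ->
    model_dist kappa (v' j) q' = d (v j) q ->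
    d p q <= model_dist kappa p' q'.

(* For [kappa > 0] only. *)
Definition is_CAT (kappa : R) (X : metricType R) : Prop :=
  (forall x y : X, mdist x y < D_ kappa ->
     exists S, geodesic_segment mdist x y S) /\
  (forall (v : 'I_3 -> X) (e : 'I_3 -> set X),
     geodesic_triangle mdist v e -> perimeter mdist v < 2 * D_ kappa ->
     CAT_inequality mdist kappa v e).

End CAT.

Section Halpern.
Context {R : realType} {X : metricType R}.

Definition nonexpansive_on (C : set X) (T : X -> X) : Prop :=
  forall x y, C x -> C y -> mdist (T x) (T y) <= mdist x y.

Definition halpern_iteration (T : X -> X) (lambda : nat -> R) (u : X)
    (x : nat -> X) : Prop :=
  x 0%N = u /\
  forall n, is_convex_comb mdist (1 - lambda n.+1) u (T (x n)) (x n.+1).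

End Halpern.

(* Positive reals and positive integers are not types of their own here:
   sequences and moduli are total functions, constrained and used only on
   positive arguments. *)
Definition halpern_rates {R : realType} (lambda : nat -> R)
    (alpha gamma : R -> nat) (theta : nat -> nat) : Prop :=
  [/\ forall eps : R, 0 < eps -> forall n, (alpha eps <= n)%N ->
        lambda n.+1 <= eps,
      forall eps : R, 0 < eps -> forall n, (0 < n)%N ->
        \sum_((gamma eps).+1 <= i < (gamma eps + n).+1)
           `|lambda i.+1 - lambda i| <= eps
    & forall n, (0 < n)%N ->
        n%:R <= \sum_(1 <= k < (theta n).+1) lambda k.+1].

(* Used only at [x > 0], where it is the ceiling of [x]. *)
Definition nceil {R : realType} (x : R) : nat := `|Num.ceil x|%N.

Section Bounds.
Context {R : realType}.
Variables (eps : R) (g : nat -> nat) (kappa M : R).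
Variables (theta : nat -> nat) (alpha gamma : R -> nat).

Local Notation Mk := (M * Num.sqrt kappa).

Definition sin2eps : R := sin (eps * Num.sqrt kappa / 4) ^+ 2.

Definition eps0 : R := cos Mk / 36 * sin2eps.

Definition Bnum : nat := nceil (Mk * tan Mk / (1 - cos eps0)).

Definition L_fun (i : nat) (delta : R) : R :=
  cos Mk * delta / (4 * Mk * i.+1%:R).

Definition chi (i : nat) (delta : R) : nat :=
  maxn (theta (nceil (cos Mk)^-1 *
               (gamma (L_fun i delta) +
                `|Num.max (Num.ceil (ln (L_fun i delta)^-1)) 1|))%N)
       (alpha (2 * L_fun i delta)).

Definition chi_star (i : nat) (delta : R) : nat :=
  chi i (delta / 2 * cos Mk).

Definition Tint (delta : R) : int :=
  Num.ceil (ln (3 / delta * sin (Mk / 2) ^+ 2)).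

(* Here and in [Afun], truncated subtraction is harmless because [chi_star]
   is positive. *)
Definition Theta (i : nat) (delta : R) : nat :=
  (theta (nceil (cos Mk)^-1 *
          (chi_star i (delta / 3) - 1 + `|Num.max (Tint delta) 1|))%N).+1.

Definition Delta_star (i : nat) (delta : R) : R :=
  delta / (3 * (Theta i delta)%:R - 3 * (chi_star i (delta / 3))%:R
           + 3 * (g (Theta i delta))%:R).

Definition f_fun (i : nat) : nat :=
  (maxn (nceil (Mk / Delta_star i sin2eps)) i - i)%N.

Definition f_star (i : nat) : nat :=
  (f_fun (i + nceil eps0^-1) + nceil eps0^-1)%N.

Definition f_tilde (i : nat) : nat := (i + f_star i)%N.

Definition theta_plus (n : nat) : nat := (\max_(1 <= i < n.+1) theta i)%N.

Definition Gamma (n : nat) : nat :=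
  (\max_(nceil eps0^-1 <= i < n.+1) chi_star i (3^-1 * sin2eps)%R)%N.

Definition Sint : int := Num.ceil (ln (3 * sin (Mk / 2) ^+ 2 / sin2eps)).

Definition Afun (n : nat) : nat :=
  (theta_plus (nceil (cos Mk)^-1 *
               (Gamma n - 1 + `|Num.max Sint 1|))%N).+1.

Definition K_bound : nat := (iter Bnum f_tilde 0 + nceil eps0^-1)%N.

Definition Sigma : nat := Afun K_bound.

End Bounds.

(* Main.v *)
Require Import Defs.
From HB Require Import structures.
From mathcomp Require Import all_boot all_order all_algebra.
From mathcomp Require Import all_classical all_reals all_analysis.
From mathcomp Require Import ring lra zify.

Set Implicit Arguments.
Unset Strict Implicit.
Unset Printing Implicit Defensive.

Import Order.TTheory GRing.Theory Num.Theory.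
Import numFieldNormedType.Exports.

Local Open Scope classical_set_scope.
Local Open Scope ring_scope.

(* Distances are rescaled to angles, rho = sqrt kappa * d.  A comparison triangle
   in the unit sphere gives, for m = (1 - t) x + t y,
     sin (rho x y) cos (rho p m) >= sin ((1 - t) rho x y) cos (rho p x)
                                    + sin (t rho x y) cos (rho p y),
   and everything else about X follows from this inequality.  Applied twice, it
   makes z |-> u / (i + 1) + i / (i + 1) T z a contraction; its fixed points z_i
   have nondecreasing distance to u, so this bounded monotone sequence has an
   interval [K0, J] of metastability.  By asymptotic regularity the resolvent
   z_K0 shows that T x_n is asymptotically no closer to u than z_K0, hence hardly
   closer than z_J.  Since z_J is almost fixed by T, the quantities
   1 - cos (rho z_J x_n) satisfy a perturbed contractive recursion, which bounds
   the distance of x_n to z_J by eps / 2 for all n in [N, N + g N]. *)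

(** * Trigonometric estimates *)

(** The delicate point is the order of choices. The threshold [chi_star] of regularity and the start
    [Theta] of the window depend on the resolvent that bounds the distance from [u] to [T (x n)]
    from below. The displacement of the resolvent being approached, at most [b / (J + 1)] for z_J
    with [b = M * sqrt kappa], is an error incurred at every step up to the end of that window. One
    resolvent cannot play both roles: K0 is fixed first, and J is read off from the window that K0
    determines; [f_tilde] makes this choice. Only the distances of z_K0 and z_J to [u] are compared,
    so metastability of a monotone real sequence suffices and no bound on the distance between the
    two points is used. Since [M < D_kappa / 2], all angles stay below [pi / 2] and [cos b] is
    positive; [cos b * lambda] is the strength of the contraction in each step. The target accuracy
    is [2 * d = 1 - cos (eps * sqrt kappa / 2)] with [d = sin2eps], and most numerical constants
    split this budget. *)

Lemma sin_MVT (R : realType) (a b : R) : a <= b ->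
  exists2 c, a <= c <= b & sin b - sin a = cos c * (b - a).
Proof.
move=> ab; have [|c] := MVT_segment ab (fun x _ => is_derive_sin x).
  exact/continuous_subspaceT/continuous_sin.
by rewrite in_itv => ? ?; exists c.
Qed.

Lemma cos_lipschitz (R : realType) (a b : R) : `|cos a - cos b| <= `|a - b|.
Proof.
wlog ab : a b / a <= b.
  by move=> H; have [/H//|/ltW/H] := leP a b; rewrite distrC (distrC b).
have [|c _] := MVT_segment ab (fun x _ => is_derive_cos x).
  exact/continuous_subspaceT/continuous_cos.
rewrite distrC => ->; rewrite normrM normrN (distrC a).
by rewrite -[leRHS]mul1r ler_wpM2r// sin_max.
Qed.

Lemma ler_cos (R : realType) (x y : R) :
  0 <= x -> x <= y -> y <= pi -> cos y <= cos x.
Proof.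
move=> x0; rewrite le_eqVlt => /predU1P[->//|xy ypi].
by apply/ltW; rewrite ltr_cos// in_itv/=; lra.
Qed.

Lemma sin_ge0_pihalf (R : realType) (x : R) : 0 <= x <= pi / 2 -> 0 <= sin x.
Proof. by move=> ?; apply: sin_ge0_pi; have := pi_ge0 R; lra. Qed.

Lemma ler_sin_pihalf (R : realType) (x y : R) :
  0 <= x <= pi / 2 -> 0 <= y <= pi / 2 -> (sin x <= sin y) = (x <= y).
Proof. by move=> hx hy; rewrite !leNgt ltr_sin// in_itv/=; lra. Qed.

Lemma sin_le_id (R : realType) (x : R) : 0 <= x -> sin x <= x.
Proof.
move=> x0; have [c _] := sin_MVT x0; rewrite sin0 !subr0 => ->.
by rewrite -[leRHS]mul1r ler_wpM2r// cos_le1.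
Qed.

Lemma sin_ge_mul_cos (R : realType) (x : R) :
  0 <= x <= pi -> x * cos x <= sin x.
Proof.
move=> /andP[x0 xpi]; have [c c0x] := sin_MVT x0; rewrite sin0 !subr0 => ->.
by rewrite mulrC ler_wpM2r//; apply: ler_cos; lra.
Qed.

Lemma sin_sub_le (R : realType) (a h : R) :
  0 <= h <= a -> a <= pi -> sin (a - h) <= sin a - h * cos a.
Proof.
move=> ha api; have [|c cE] := @sin_MVT R (a - h) a; first by lra.
rewrite (_ : a - (a - h) = h); last by ring.
have : cos a <= cos c by apply: ler_cos; lra.
by move=> /(ler_wpM2l (proj1 (andP ha))); lra.
Qed.

Lemma sin_concave0 (R : realType) (k y : R) :
  0 <= k <= 1 -> 0 <= y <= pi -> k * sin y <= sin (k * y).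
Proof.
move=> k01 y0pi.
have [k0 k1] := andP k01; have [y0 ypi] := andP y0pi.
have ky0 : 0 <= k * y by rewrite mulr_ge0.
have kyy : k * y <= y by rewrite -[leRHS]mul1r ler_wpM2r.
have [c1 c1E] := sin_MVT ky0; rewrite sin0 !subr0 => s1.
have [c2 c2E s2] := sin_MVT kyy.
have c21 : cos c2 <= cos c1 by apply: ler_cos; lra.
have : k * (sin y - sin (k * y)) <= (1 - k) * sin (k * y).
  rewrite s2 s1 -subr_ge0.
  rewrite (_ : _ - _ = k * (1 - k) * y * (cos c1 - cos c2)); last by ring.
  by rewrite !mulr_ge0//; lra.
lra.
Qed.

(** The tangent at [A] lies above the sine, and the drop [(1 - t) * A * cos A] along it is at least
    [(1 - t) * cos M * sin A]. This is the source of the factor [1 - (1 - t) * cos M] in all later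
    contractions. *)
Lemma sin_scale_le (R : realType) (M A t : R) :
  0 <= A <= M -> M <= pi / 2 -> 0 <= t <= 1 ->
  sin (t * A) <= (1 - (1 - t) * cos M) * sin A.
Proof.
move=> /andP[A0 AM] Mpi t01; have := pi_ge0 R => pi0.
have hA : 0 <= (1 - t) * A <= A.
  have -> : (1 - t) * A = A - t * A by ring.
  have [t0 t1] := andP t01.
  have : t * A <= 1 * A by rewrite ler_wpM2r.
  have : 0 <= t * A by rewrite mulr_ge0.
  lra.
have -> : t * A = A - (1 - t) * A by ring.
apply: le_trans (sin_sub_le hA _) _; first by lra.
have cMA : cos M <= cos A by apply: ler_cos; lra.
have cM0 : 0 <= cos M by apply: cos_ge0_pihalf; lra.
have sA : 0 <= sin A by apply: sin_ge0_pihalf; lra.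
have := sin_le_id A0 => sAA.
have : sin A * cos M <= A * cos A by rewrite ler_pM.
have t1 : 0 <= 1 - t by lra.
move=> /(ler_wpM2l t1); lra.
Qed.

Lemma cos_half (R : realType) (x : R) : 1 - cos x = 2 * sin (x / 2) ^+ 2.
Proof.
have := cos_mulr2n (x / 2); rewrite cos2sin2.
by rewrite (_ : x / 2 *+ 2 = x) => [->|]; [ring|rewrite -mulr_natr; field].
Qed.

Lemma one_sub_cos_le (R : realType) (x : R) : 0 <= x -> 1 - cos x <= x ^+ 2 / 2.
Proof.
move=> x0; rewrite -cos_norm cos_half ger0_norm//.
have h0 : 0 <= x / 2 by lra.
have := sin_le_id h0; have [s0|s0] := leP 0 (sin (x / 2)) => h.
  have : sin (x / 2) ^+ 2 <= (x / 2) ^+ 2 by rewrite lerXn2r.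
  by rewrite expr_div_n; lra.
(* A negative sine forces [x > 2 pi], where [x ^+ 2 / 2] exceeds 2. *)
have [xpi|xpi] := leP x (pi *+ 2).
  have : 0 <= sin (x / 2) by apply: sin_ge0_pi; rewrite mulr2n in xpi; lra.
  lra.
have := pi_ge2 R; rewrite mulr2n in xpi => pi2.
have : sin (x / 2) ^+ 2 <= 1 by rewrite sin2cos2; have := sqr_ge0 (cos (x / 2)); lra.
have : 4 * 4 <= x * x by rewrite ler_pM//; lra.
rewrite expr2; lra.
Qed.

(* [A], [B] are the sides at the apex of a triangle with third side [q], and [m]
   is the distance of the points at fraction [t] of the sides [A] and [B]. *)
Lemma cone_contraction (R : realType) (M A B q m t : R) :
  0 <= A <= M -> 0 <= B <= M -> M <= pi / 2 -> 0 <= t <= 1 ->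
  0 < sin A * sin B -> `|A - B| <= q -> q <= pi / 2 -> 0 <= m <= pi / 2 ->
  sin (t * A) * sin (t * B) * (cos q - cos A * cos B)
    + cos (t * A) * cos (t * B) * (sin A * sin B)
  <= sin A * sin B * cos m ->
  m <= (1 - (1 - t) * cos M) * q.
Proof.
move=> hA hB hM ht sAB ABq hq hm H.
have cM : 0 <= cos M <= 1.
  by rewrite cos_le1 andbT; apply: cos_ge0_pihalf; have := pi_ge0 R; lra.
set k := 1 - _.
have kt : t <= k.
  have : (1 - t) * cos M <= (1 - t) * 1 by rewrite ler_wpM2l//; lra.
  rewrite /k; lra.
have k1 : k <= 1.
  have : 0 <= (1 - t) * cos M by rewrite mulr_ge0//; lra.
  rewrite /k; lra.
have k0 : 0 <= k by lra.
have sA0 : 0 <= sin A by apply: sin_ge0_pihalf; lra.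
have sB0 : 0 <= sin B by apply: sin_ge0_pihalf; lra.
have tx x : 0 <= x <= M -> 0 <= t * x <= pi / 2.
  move=> /andP[x0 xM]; have [t0 t1] := andP ht.
  rewrite mulr_ge0//=; have : t * x <= 1 * x by rewrite ler_wpM2r.
  lra.
have sa := sin_scale_le hA hM ht; have sb := sin_scale_le hB hM ht.
rewrite -/k in sa sb.
have sa0 : 0 <= sin (t * A) by apply: sin_ge0_pihalf; exact: tx.
have sb0 : 0 <= sin (t * B) by apply: sin_ge0_pihalf; exact: tx.
(* By the spherical law of cosines, [C] is the cosine of the comparison angle at the apex;
   [|A - B| <= q] keeps it at most 1. *)
set C := (cos q - cos A * cos B) / (sin A * sin B).
have qE : cos q = cos A * cos B + sin A * sin B * C.
  by rewrite /C [_ * (_ / _)]mulrC divfK ?gt_eqF//; ring.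
have C1 : C <= 1.
  rewrite /C ler_pdivrMr// mul1r lerBlDl -cosB -(cos_norm (A - B)).
  by apply: ler_cos => //; have := pi_ge0 R; lra.
have m1 : cos (t * A) * cos (t * B) + sin (t * A) * sin (t * B) * C <= cos m.
  rewrite -(ler_pM2l sAB); move: H; rewrite qE => H; apply: le_trans H.
  by rewrite le_eqVlt; apply/orP; left; apply/eqP; ring.
have sab : sin (t * A) * sin (t * B) <= k ^+ 2 * (sin A * sin B).
  have : sin (t * A) * sin (t * B) <= (k * sin A) * (k * sin B).
    by rewrite ler_pM.
  by rewrite (_ : k * sin A * (k * sin B) = k ^+ 2 * (sin A * sin B)); last ring.
have sd : 1 - cos (t * A - t * B) <= k ^+ 2 * (1 - cos (A - B)).
  rewrite -mulrBr -cos_norm normrM (ger0_norm (proj1 (andP ht))).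
  rewrite -(cos_norm (A - B)).
  have nAB : `|A - B| <= M by rewrite ler_norml; lra.
  set d := `|A - B| in nAB *; have d0 : 0 <= d by exact: normr_ge0.
  have hd : 0 <= d / 2 <= M by lra.
  rewrite !cos_half (mulrCA _ 2) ler_pM2l// -exprMn lerXn2r ?nnegrE//.
  - by rewrite -mulrA; apply: sin_ge0_pihalf; exact: tx.
  - by rewrite mulr_ge0//; apply: sin_ge0_pihalf; lra.
  - by rewrite -mulrA; exact: sin_scale_le.
(* [1 - cos q] is the sum of [1 - cos (A - B)] and [sin A * sin B * (1 - C)], and scaling by [t]
   shrinks each summand at least by [k ^+ 2]. Half angles and concavity of the sine then give
   [m <= k * q]. *)
have : 1 - cos m <= k ^+ 2 * (1 - cos q).
  have := ler_wpM2r (_ : 0 <= 1 - C) sab; rewrite subr_ge0 => /(_ C1).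
  rewrite qE; move: sd m1; rewrite !cosB.
  move: (sin _ * sin _) (cos _ * cos _) (sin A * sin B) (cos A * cos B) => x y X Y.
  by nra.
rewrite !cos_half (mulrCA _ 2) ler_pM2l// -exprMn.
have pi0 := pi_ge0 R.
have q0 : 0 <= q by rewrite (le_trans _ ABq).
rewrite -(@ler_sqrt _ _ (_ ^+ 2)) ?sqr_ge0// !sqrtr_sqr !ger0_norm; first last.
- by apply: sin_ge0_pihalf; lra.
- by rewrite mulr_ge0//; apply: sin_ge0_pihalf; lra.
have kq : k * (q / 2) <= 1 * (q / 2) by rewrite ler_wpM2r//; lra.
have kq0 : 0 <= k * (q / 2) by rewrite mulr_ge0//; lra.
move=> h; suff : m / 2 <= k * (q / 2) by lra.
rewrite -ler_sin_pihalf; [|lra|lra].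
by apply: (le_trans h); apply: sin_concave0; lra.
Qed.

(* As in [cone_contraction], but with the points at fractions [s] of [A] and [t]
   of [B]. *)
Lemma cone_monotone (R : realType) (A B q m s t : R) :
  0 < A <= pi / 2 -> 0 < B <= pi / 2 -> 0 <= t -> t < s -> s <= 1 ->
  `|A - B| <= q -> 0 <= q -> q <= m -> m <= pi / 2 ->
  sin (s * A) * sin (t * B) * (cos q - cos A * cos B)
    + cos (s * A) * cos (t * B) * (sin A * sin B)
  <= sin A * sin B * cos m ->
  t * B <= s * A.
Proof.
move=> hA hB t0 ts s1 ABq q0 qm hm H; rewrite leNgt; apply/negP => ab.
have pi0 := pi_ge0 R.
have [A0 Api] := andP hA; have [B0 Bpi] := andP hB.
have tgt0 : 0 < t.
  rewrite lt_neqAle t0 andbT eq_sym; apply/eqP => t0'; move: ab.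
  by rewrite t0' mul0r ltNge mulr_ge0//; lra.
(* If [s * A < t * B], passing from [(A, B)] to [(s * A, t * B)] strictly shrinks the difference of
   the sides and does not increase the product of their sines, so the comparison would give
   [m < q]. *)
have AB : A < B.
  rewrite ltNge; apply/negP => BA; move: ab; rewrite ltNge => /negP; apply.
  by rewrite ler_pM//; lra.
have sAA : s * A <= A by rewrite -[leRHS]mul1r ler_wpM2r//; lra.
have sA0 : 0 <= s * A by rewrite mulr_ge0//; lra.
have tBB : t * B <= B by rewrite -[leRHS]mul1r ler_wpM2r//; lra.
have dlt : t * B - s * A < B - A.
  have h1 : (1 - s) * A <= (1 - s) * B by rewrite ler_wpM2l//; lra.
  have h2 : 0 < (s - t) * B by rewrite mulr_gt0//; lra.
  nra.
have sAp : 0 < sin A by apply: sin_gt0_pi; lra.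
have sBp : 0 < sin B by apply: sin_gt0_pi; lra.
have clt : cos (B - A) < cos (t * B - s * A).
  by rewrite ltr_cos// in_itv/=; lra.
have cq : cos q <= cos (B - A).
  by apply: ler_cos; [lra| move: ABq; rewrite distrC => /(le_trans (ler_norm _))| lra].
have cm : cos m <= cos q by apply: ler_cos; lra.
have xX : sin (s * A) * sin (t * B) <= sin A * sin B.
  apply: ler_pM.
  - by apply: sin_ge0_pihalf; lra.
  - by apply: sin_ge0_pihalf; lra.
  - by rewrite ler_sin_pihalf; lra.
  - by rewrite ler_sin_pihalf; lra.
have X0 : 0 < sin A * sin B by rewrite mulr_gt0.
move: H clt cq cm; rewrite !cosB.
rewrite (mulrC (sin (t * B))) (mulrC (sin B)) (mulrC (cos (t * B))) (mulrC (cos B)).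
move: xX X0 (cos q) (cos m).
move: (sin _ * sin _) (cos _ * cos _) (sin A * sin B) (cos A * cos B) => x y X Y.
move=> xX X0 cq cm h1 h2 h3 h4.
have : X * cm <= X * cq by rewrite ler_pM2l.
have : (X - x) * cq <= (X - x) * (Y + X) by rewrite ler_wpM2l// subr_ge0.
have : X * (Y + X) < X * (y + x) by rewrite ltr_pM2l.
nra.
Qed.

(** * The cosine inequality in CAT(kappa) spaces *)

Section DotProduct.
Context {R : realType}.
Implicit Types u v w : 'rV[R]_3.

Lemma dotpE u v : dotp u v = \sum_k u 0 k * v 0 k.
Proof. by rewrite /dotp mxE; apply: eq_bigr => k _; rewrite mxE. Qed.

Lemma dotpC u v : dotp u v = dotp v u.
Proof. by rewrite !dotpE; apply: eq_bigr => k _; rewrite mulrC. Qed.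

Lemma dotpDl u v w : dotp (u + v) w = dotp u w + dotp v w.
Proof. by rewrite /dotp mulmxDl mxE. Qed.

Lemma dotpZl a u v : dotp (a *: u) v = a * dotp u v.
Proof. by rewrite /dotp -scalemxAl mxE. Qed.

Lemma dotpDr u v w : dotp u (v + w) = dotp u v + dotp u w.
Proof. by rewrite !(dotpC u) dotpDl. Qed.

Lemma dotpZr a u v : dotp u (a *: v) = a * dotp u v.
Proof. by rewrite !(dotpC u) dotpZl. Qed.

Definition dotp_linear := (dotpDl, dotpDr, dotpZl, dotpZr).

Lemma dotp_ge0 u : 0 <= dotp u u.
Proof. by rewrite dotpE; apply: sumr_ge0 => k _; rewrite -expr2 sqr_ge0. Qed.

Lemma dotp_eq0 u : dotp u u = 0 -> u = 0.
Proof.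
rewrite dotpE => /psumr_eq0P u0; apply/rowP => k.
have /eqP := u0 (fun i _ => sqr_ge0 (u 0 i)) k isT.
by rewrite -expr2 sqrf_eq0 mxE => /eqP.
Qed.

End DotProduct.

Section Sphere.
Context {R : realType}.
Implicit Types u v w m : @sphere R.

Lemma sphere1 u : dotp (val u) (val u) = 1.
Proof. exact/eqP/(valP u). Qed.

Definition sphere_point (w : 'rV[R]_3) (w1 : dotp w w == 1) : sphere := exist _ w w1.

Lemma dotp_sphere_itv u v : -1 <= dotp (val u) (val v) <= 1.
Proof.
have := dotp_ge0 (val u + val v); have := dotp_ge0 (val u + (-1) *: val v).
rewrite !dotp_linear !sphere1 (dotpC (val v)); lra.
Qed.

Lemma sphere_eq u v : dotp (val u) (val v) = 1 -> u = v.
Proof.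
move=> uv; apply/val_inj/eqP; rewrite -subr_eq0 -scaleN1r; apply/eqP/dotp_eq0.
by rewrite !dotp_linear !sphere1 (dotpC (val v)) uv; ring.
Qed.

(* Both sides have the same square norm [sin^2 (a + b)], which is also their
   dot product. *)
Lemma slerp u v m a b :
  dotp (val u) (val v) = cos (a + b) -> dotp (val u) (val m) = cos a ->
  dotp (val m) (val v) = cos b ->
  sin (a + b) *: val m = sin b *: val u + sin a *: val v.
Proof.
move=> uv um mv; apply/eqP; rewrite -subr_eq0 -scaleN1r; apply/eqP/dotp_eq0.
rewrite !dotp_linear !sphere1 (dotpC (val v)) (dotpC (val m) (val u)) um.
rewrite (dotpC (val v)) uv mv cosD sinD.
have := cos2Dsin2 a; have := cos2Dsin2 b; rewrite !expr2.
move: (cos a) (sin a) (cos b) (sin b) => x y z w h1 h2.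
have z2 : z * z = 1 - w * w by lra.
have x2 : x * x = 1 - y * y by lra.
transitivity (y * y * (z * z) + x * x * (w * w) - 2 * (y * w) * (x * z)
 - 2 * (w * y) * (w * y) + w * w * (1 - 2 * (x * x)) + y * y * (1 - 2 * (z * z))
 + 2 * (w * y) * (x * z)); first by ring.
by rewrite z2 x2; ring.
Qed.

(** [CAT_inequality] quantifies over comparison triangles, so one has to be exhibited before it says
    anything. Here [u] is the first basis vector, [v] lies in the first coordinate plane, and [w] is
    turned out of it by the angle at [u]. *)
Lemma comparison_triangle (a b c : R) :
  0 <= a <= pi / 2 -> 0 <= b <= pi / 2 -> `|a - b| <= c <= a + b ->
  exists u v w, [/\ dotp (val u) (val v) = cos a, dotp (val u) (val w) = cos b
    & dotp (val v) (val w) = cos c].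
Proof.
move=> ha hb /andP[abc cab].
have sa : 0 <= sin a by exact: sin_ge0_pihalf.
have sb : 0 <= sin b by exact: sin_ge0_pihalf.
have c0 : 0 <= c by rewrite (le_trans _ abc).
have c1 : cos c <= cos a * cos b + sin a * sin b.
  rewrite -cosB -(cos_norm (a - b)); apply: ler_cos => //; lra.
have c2 : cos a * cos b - sin a * sin b <= cos c.
  rewrite -cosD; apply: ler_cos => //; lra.
(* [x] is the cosine of the angle at [u]; it is [0], by [_ / 0 = 0], when that
   angle is undefined, and any angle will do. *)
set x := (cos c - cos a * cos b) / (sin a * sin b).
have xE : sin a * sin b * x = cos c - cos a * cos b.
  have [sab|sab] := eqVneq (sin a * sin b) 0; last by rewrite mulrC divfK.
  by rewrite /x sab; move: c1 c2; rewrite sab; lra.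
have x1 : x ^+ 2 <= 1.
  have [sab|sab] := eqVneq (sin a * sin b) 0.
    by rewrite /x sab invr0 mulr0 expr0n.
  have {}sab : 0 < sin a * sin b by rewrite lt_neqAle eq_sym sab mulr_ge0.
  have : `|x| <= 1 by rewrite ler_norml -(ler_pM2l sab) -[x <= 1](ler_pM2l sab) xE; lra.
  by rewrite -real_normK ?num_real// expr_le1// normr_ge0.
set y := Num.sqrt (1 - x ^+ 2).
have y2 : y * y = 1 - x ^+ 2 by rewrite -expr2 sqr_sqrtr// subr_ge0.
pose vec (r s t : R) : 'rV[R]_3 := \row_(k < 3) nth 0 [:: r; s; t] k.
have vecE r s t r' s' t' :
    dotp (vec r s t) (vec r' s' t') = r * r' + s * s' + t * t'.
  by rewrite dotpE !big_ord_recl big_ord0 !mxE/= addr0 !addrA.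
have u1 : dotp (vec 1 0 0) (vec 1 0 0) == 1 by rewrite vecE; apply/eqP; ring.
have v1 : dotp (vec (cos a) (sin a) 0) (vec (cos a) (sin a) 0) == 1.
  by rewrite vecE mulr0 addr0 -!expr2 cos2Dsin2.
have w1 : let w := vec (cos b) (sin b * x) (sin b * y) in dotp w w == 1.
  rewrite /= vecE; apply/eqP; rewrite -(cos2Dsin2 b) mulrACA [X in _ + X]mulrACA.
  by rewrite y2; ring.
exists (sphere_point u1), (sphere_point v1), (sphere_point w1); split; rewrite /= vecE.
- by ring.
- by ring.
- by rewrite mul0r addr0 mulrA xE; ring.
Qed.

Variables (kappa : R) (kappa_gt0 : 0 < kappa).
Let sk_gt0 : 0 < Num.sqrt kappa. Proof. by rewrite sqrtr_gt0. Qed.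

Lemma model_distE u v :
  Num.sqrt kappa * model_dist kappa u v = acos (dotp (val u) (val v)).
Proof. by rewrite /model_dist mulrC divfK// gt_eqF. Qed.

Lemma cos_model_dist u v :
  cos (Num.sqrt kappa * model_dist kappa u v) = dotp (val u) (val v).
Proof. by rewrite model_distE acosK// in_itv/= dotp_sphere_itv. Qed.

Lemma model_distxx u : model_dist kappa u u = 0.
Proof. by rewrite /model_dist sphere1 acos1 mul0r. Qed.

Lemma model_dist_eq u v d : 0 <= Num.sqrt kappa * d <= pi ->
  dotp (val u) (val v) = cos (Num.sqrt kappa * d) -> model_dist kappa u v = d.
Proof.
move=> hd uv; apply: (mulfI (lt0r_neq0 sk_gt0)).
by rewrite model_distE uv cosK// in_itv.
Qed.

Lemma sphere_segment u v : -1 < dotp (val u) (val v) ->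
  exists S, geodesic_segment (model_dist kappa) u v S.
Proof.
move=> uv; have [uv1|uv1] := eqVneq (dotp (val u) (val v)) 1.
  exists ((fun=> u) @` [set s | 0 <= s <= model_dist kappa u v]); exists (fun=> u) => //.
  rewrite /is_geodesic -(sphere_eq uv1) !model_distxx; split=> // s t s0 t0.
  by rewrite (_ : s = t) ?subrr ?normr0//; lra.
have /andP[_ uvle1] := dotp_sphere_itv u v.
have uv_lt1 : dotp (val u) (val v) < 1 by rewrite lt_neqAle uv1.
set D := acos (dotp (val u) (val v)).
have Ditv : 0 < D < pi by rewrite acos_gt0 ?acos_ltpi//; lra.
have sD : 0 < sin D by exact: sin_gt0_pi.
have cD : cos D = dotp (val u) (val v) by rewrite acosK// in_itv/=; lra.
(* [n] is the unit tangent at [u] towards [v], by Gram-Schmidt. It requires [sin D] to be nonzero,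
   hence the exclusion of equal and antipodal points. *)
have [n [un nn vE]] : exists n, [/\ dotp (val u) n = 0, dotp n n = 1 &
    val v = cos D *: val u + sin D *: n].
  exists ((sin D)^-1 *: (val v + (- cos D) *: val u)); split.
  - by rewrite !dotp_linear sphere1 cD; ring.
  - rewrite !dotp_linear !sphere1 (dotpC (val v)) -cD.
    transitivity ((sin D)^-1 * (sin D)^-1 * (1 - cos D ^+ 2)); first by ring.
    by rewrite -sin2cos2; field; rewrite gt_eqF.
  - by rewrite scalerA divff ?gt_eqF// scale1r addrC scaleNr subrK.
pose arc s := cos s *: val u + sin s *: n.
have arcE s t : dotp (arc s) (arc t) = cos (s - t).
  by rewrite /arc !dotp_linear sphere1 (dotpC n) un nn cosB; ring.
have arc1 s : dotp (arc s) (arc s) == 1 by rewrite arcE subrr cos0.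
pose c s := sphere_point (arc1 (Num.sqrt kappa * s)).
have kd : Num.sqrt kappa * model_dist kappa u v = D by exact: model_distE.
exists (c @` [set s | 0 <= s <= model_dist kappa u v]); exists c => //; split.
- by apply: val_inj; rewrite /= mulr0 /arc cos0 sin0 scale1r scale0r addr0.
- by apply: val_inj; rewrite /= kd /arc vE.
- move=> s t hs ht; apply: model_dist_eq; last first.
    rewrite /= arcE -mulrBr -cos_norm normrM gtr0_norm//.
  have : `|s - t| <= model_dist kappa u v by rewrite ler_norml; lra.
  move=> /(ler_wpM2l (ltW sk_gt0)); rewrite kd => h.
  by rewrite mulr_ge0 ?normr_ge0 ?(ltW sk_gt0)//=; lra.
Qed.

End Sphere.

Definition angdist {R : realType} (kappa : R) {X : metricType R} (p q : X) : R :=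
  Num.sqrt kappa * mdist p q.

Section AngularDistance.
Context {R : realType} {kappa : R} {X : metricType R}.
Local Notation rho := (angdist kappa).

Lemma angdist_ge0 (p q : X) : 0 <= rho p q.
Proof. by rewrite mulr_ge0// ?sqrtr_ge0// mdist_ge0. Qed.

Lemma angdistC (p q : X) : rho p q = rho q p.
Proof. by rewrite /angdist metric_sym. Qed.

Lemma angdist_triangle (p q r : X) : rho p r <= rho p q + rho q r.
Proof. by rewrite -mulrDr ler_wpM2l ?sqrtr_ge0// metric_triangle. Qed.

Lemma angdistB (p q r : X) : `|rho p q - rho p r| <= rho q r.
Proof.
have := angdist_triangle p q r; have := angdist_triangle p r q.
by rewrite ler_norml (angdistC r q); lra.
Qed.

Lemma convex_comb_angdist t (x y m : X) : is_convex_comb mdist t x y m ->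
  rho x m = t * rho x y /\ rho m y = (1 - t) * rho x y.
Proof.
move=> [S [_ _ dx dy]]; rewrite /angdist (metric_sym x) dx dy.
by rewrite !(mulrCA (Num.sqrt _)).
Qed.

End AngularDistance.

Section CATcos.
Context {R : realType} (kappa : R) (X : metricType R).
Hypotheses (kappa_gt0 : 0 < kappa) (catX : is_CAT kappa X).
Local Notation rho := (angdist kappa).
Let sk_gt0 : 0 < Num.sqrt kappa. Proof. by rewrite sqrtr_gt0. Qed.

(* On the unit sphere this is an equality, see [slerp]. *)
Lemma CAT_cos (t : R) (p x y m : X) :
  0 <= t <= 1 -> rho x y <= pi / 2 -> rho p x <= pi / 2 -> rho p y <= pi / 2 ->
  is_convex_comb mdist t x y m ->
  sin ((1 - t) * rho x y) * cos (rho p x) + sin (t * rho x y) * cos (rho p y)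
    <= sin (rho x y) * cos (rho p m).
Proof.
move=> t01 xy px py xym; have [rxm rmy] := convex_comb_angdist (kappa := kappa) xym.
case: xym => S0 [S0xy S0m dmx dmy].
have pi2 := pi_ge2 R.
have ltD (a b : X) : rho a b <= pi / 2 -> mdist a b < D_ kappa.
  by move=> ab; rewrite /D_ ltr_pdivlMr// mulrC; move: ab; rewrite /angdist; lra.
have [S1 S1yp] : exists S, geodesic_segment mdist y p S.
  by apply: catX.1; apply: ltD; rewrite angdistC.
have [S2 S2px] : exists S, geodesic_segment mdist p x S.
  by apply: catX.1; apply: ltD.
pose v (i : 'I_3) := nth x [:: x; y; p] i.
pose e (i : 'I_3) := nth S0 [:: S0; S1; S2] i.
have tri : geodesic_triangle mdist v e by case=> [[|[|[|]]]].
have perimE : Num.sqrt kappa * perimeter mdist v = rho x y + (rho p y + rho p x).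
  rewrite /perimeter !big_ord_recl big_ord0 addr0 !mulrDr (angdistC p y).
  by congr (_ * mdist _ _ + (_ * mdist _ _ + _ * mdist _ _)).
have perim : perimeter mdist v < 2 * D_ kappa.
  rewrite -(ltr_pM2l sk_gt0) perimE /D_ mulrCA (mulrC (Num.sqrt _)) divfK ?gt_eqF//.
  lra.
have [|||u' [v' [w' [uv uw vw]]]] := @comparison_triangle _ (rho x y) (rho x p) (rho y p).
- by rewrite angdist_ge0.
- by rewrite angdist_ge0 angdistC.
- by rewrite angdistB (angdistC x y) angdist_triangle.
have md (a b : X) (a' b' : sphere) : rho a b <= pi / 2 ->
    dotp (val a') (val b') = cos (rho a b) -> model_dist kappa a' b' = mdist a b.
  move=> ab h; apply: model_dist_eq => //.
  by have := @angdist_ge0 _ kappa _ a b; move: ab; rewrite /angdist; lra.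
have md01 := md _ _ _ _ xy uv.
have md12 : model_dist kappa v' w' = mdist y p by apply: md => //; rewrite angdistC.
have md20 : model_dist kappa w' u' = mdist p x.
  by apply: md => //; rewrite dotpC uw angdistC.
have seg (a b : X) (a' b' : sphere) : rho a b <= pi / 2 ->
    dotp (val a') (val b') = cos (rho a b) ->
    exists S, geodesic_segment (model_dist kappa) a' b' S.
  move=> ab h; apply: sphere_segment => //; rewrite h.
  apply: (@lt_le_trans _ _ 0); first by lra.
  by apply: cos_ge0_pihalf; have := @angdist_ge0 _ kappa _ a b; lra.
have [E0 E0uv] := seg _ _ _ _ xy uv.
have [E1 E1vw] : exists S, geodesic_segment (model_dist kappa) v' w' S.
  by apply: seg vw; rewrite angdistC.
have [E2 E2wu] : exists S, geodesic_segment (model_dist kappa) w' u' S.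
  by apply: (seg _ _ _ _ px); rewrite dotpC uw angdistC.
pose vv (i : 'I_3) := nth u' [:: u'; v'; w'] i.
pose ee (i : 'I_3) := nth E0 [:: E0; E1; E2] i.
have tri' : geodesic_triangle (model_dist kappa) vv ee by case=> [[|[|[|]]]].
have sides : forall i, model_dist kappa (vv i) (vv (ordS i)) = mdist (v i) (v (ordS i)).
  by case=> [[|[|[|]]]].
have d0 := mdist_ge0 x y.
have td : 0 <= t * mdist x y <= mdist x y.
  by rewrite mulr_ge0 ?ler_piMl//; lra.
have [c [c0 c1 cE] E0E] := E0uv; rewrite md01 in c1 cE.
set m' := c (t * mdist x y).
have um : model_dist kappa u' m' = t * mdist x y.
  by rewrite -c0 cE ?lexx//= sub0r normrN ger0_norm//; lra.
have mv : model_dist kappa m' v' = (1 - t) * mdist x y.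
  rewrite -c1 cE ?lexx ?andbT// distrC ger0_norm ?subr_ge0; last by lra.
  by ring.
have E2w : E2 w'.
  case: (E2wu) => c' [c'0 _ _] ->; exists 0 => //=.
  by rewrite lexx md20 mdist_ge0.
have S2p : S2 p.
  by case: (S2px) => c' [c'0 _ _] ->; exists 0 => //=; rewrite lexx mdist_ge0.
have E0m : E0 m' by rewrite E0E; exists (t * mdist x y) => //=; rewrite md01.
(* The comparison is between [m] on the side from [x] to [y] and [p], taken as the initial vertex of
   the third side, so that its comparison point is [w'], at distance 0. *)
pose i0 : 'I_3 := Ordinal (isT : 0 < 3)%N.
pose i2 : 'I_3 := Ordinal (isT : 2 < 3)%N.
have := @catX.2 v e tri perim vv ee tri' sides i0 i2 m p m' w' S0m S2p E0m E2w.
move=> /(_ _ _)/wrap[].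
  by rewrite um (metric_sym _ m) dmx.
  by rewrite model_distxx mdistxx.
rewrite -(ler_pM2l sk_gt0) => mp.
have : dotp (val m') (val w') <= cos (rho p m).
  rewrite -(@cos_model_dist _ kappa)//; apply: ler_cos.
  - exact: angdist_ge0.
  - by rewrite angdistC.
  - by rewrite model_distE// acos_lepi// dotp_sphere_itv.
have s0 : 0 <= sin (rho x y) by apply: sin_ge0_pihalf; rewrite angdist_ge0.
move=> /(ler_wpM2l s0); apply: le_trans.
rewrite -dotpZl (_ : rho x y = t * rho x y + (1 - t) * rho x y); last by ring.
rewrite (slerp (u := u') (v := v')).
- rewrite dotpDl !dotpZl uw vw (angdistC p x) (angdistC p y).
  by rewrite -mulrDl [t + _]addrC subrK mul1r.
- by rewrite uv; congr cos; ring.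
- by rewrite -(@cos_model_dist _ kappa)// um mulrCA.
- by rewrite -(@cos_model_dist _ kappa)// mv mulrCA.
Qed.

End CATcos.

(** * Geodesic cones and fixed points of contractions *)

Section GeodesicCones.
Context {R : realType} (kappa : R) (X : metricType R).
Hypotheses (kappa_gt0 : 0 < kappa) (catX : is_CAT kappa X).
Local Notation rho := (angdist kappa).

(** [CAT_cos] is used for [q] on the side from [u] to [Q] seen from [p], then for [p] on the side
    from [u] to [P] seen from [Q]; the diagonal term [cos (rho p Q)] cancels. The result is the
    law-of-cosines hypothesis of [cone_contraction] and [cone_monotone]. *)
Lemma CAT_cos2 (s t : R) (u P Q p q : X) :
  0 <= s <= 1 -> 0 <= t <= 1 ->
  rho u P <= pi / 2 -> rho u Q <= pi / 2 -> rho P Q <= pi / 2 -> rho p Q <= pi / 2 ->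
  is_convex_comb mdist s u P p -> is_convex_comb mdist t u Q q ->
  sin (s * rho u P) * sin (t * rho u Q)
      * (cos (rho P Q) - cos (rho u P) * cos (rho u Q))
    + cos (s * rho u P) * cos (t * rho u Q) * (sin (rho u P) * sin (rho u Q))
  <= sin (rho u P) * sin (rho u Q) * cos (rho p q).
Proof.
move=> s01 t01 uP uQ PQ pQ cp cq.
have [up _] := convex_comb_angdist (kappa := kappa) cp.
have A0 : 0 <= rho u P by exact: angdist_ge0.
have B0 : 0 <= rho u Q by exact: angdist_ge0.
have sA : 0 <= s * rho u P <= rho u P by rewrite mulr_ge0 ?ler_piMl//; lra.
have tB : 0 <= t * rho u Q <= rho u Q by rewrite mulr_ge0 ?ler_piMl//; lra.
have h1 : sin ((1 - t) * rho u Q) * cos (rho p u) + sin (t * rho u Q) * cos (rho p Q)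
    <= sin (rho u Q) * cos (rho p q).
  by apply: CAT_cos => //; rewrite angdistC up; lra.
have h2 : sin ((1 - s) * rho u P) * cos (rho Q u) + sin (s * rho u P) * cos (rho Q P)
    <= sin (rho u P) * cos (rho Q p).
  by apply: CAT_cos => //; rewrite angdistC.
have sA0 : 0 <= sin (rho u P) by apply: sin_ge0_pihalf; lra.
have sB0 : 0 <= sin (t * rho u Q) by apply: sin_ge0_pihalf; lra.
move: h1 h2 => /(ler_wpM2l sA0) h1 /(ler_wpM2l sB0) h2.
move: h1 h2; rewrite !mulrBl !mul1r !sinB (angdistC p u) (angdistC Q u) (angdistC Q P).
rewrite (angdistC Q p) up; lra.
Qed.

Lemma convex_comb_contraction (M t : R) (u P Q p q : X) :
  M <= pi / 2 -> 0 <= t <= 1 ->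
  rho u P <= M -> rho u Q <= M -> rho P Q <= pi / 2 -> rho p Q <= pi / 2 ->
  rho p q <= pi / 2 ->
  is_convex_comb mdist t u P p -> is_convex_comb mdist t u Q q ->
  rho p q <= (1 - (1 - t) * cos M) * rho P Q.
Proof.
move=> Mpi t01 uP uQ PQ pQ pq cp cq.
have H := CAT_cos2 t01 t01 (le_trans uP Mpi) (le_trans uQ Mpi) PQ pQ cp cq.
have A0 : 0 <= rho u P by exact: angdist_ge0.
have B0 : 0 <= rho u Q by exact: angdist_ge0.
have pi0 := pi_ge0 R.
have cM : 0 <= cos M <= 1.
  rewrite cos_le1 andbT; apply: cos_ge0_pihalf; lra.
have tk : t <= 1 - (1 - t) * cos M.
  have : (1 - t) * cos M <= (1 - t) * 1 by rewrite ler_wpM2l//; lra.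
  lra.
have [up _] := convex_comb_angdist (kappa := kappa) cp.
have [uq _] := convex_comb_angdist (kappa := kappa) cq.
have PQB := angdistB (kappa := kappa) u P Q.
have := angdist_triangle (kappa := kappa) p u q; rewrite (angdistC p u) up uq => pq'.
have tPQ : t * rho P Q <= (1 - (1 - t) * cos M) * rho P Q.
  by rewrite ler_wpM2r// angdist_ge0.
have t0 : 0 <= t by lra.
(* With a degenerate side the angle at [u] is undefined, but the path from [p] to [q] through [u]
   already gives the factor [t]. *)
have [A1|A1] := eqVneq (rho u P) 0.
  move: PQB pq'; rewrite A1 sub0r normrN ger0_norm// => /(ler_wpM2l t0); lra.
have [B1|B1] := eqVneq (rho u Q) 0.
  move: PQB pq'; rewrite B1 subr0 ger0_norm// => /(ler_wpM2l t0); lra.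
have {}A1 : 0 < rho u P by rewrite lt_neqAle eq_sym A1.
have {}B1 : 0 < rho u Q by rewrite lt_neqAle eq_sym B1.
apply: cone_contraction H => //; rewrite ?A0 ?B0 ?angdist_ge0//.
by apply: mulr_gt0; apply: sin_gt0_pi; lra.
Qed.

(** Meant for [P = T p] and [Q = T q], where [rho P Q <= rho p q] is nonexpansiveness: resolvents
    recede from [u] as the parameter grows. *)
Lemma angdist_apex_le (s t : R) (u P Q p q : X) :
  0 <= t -> t < s -> s <= 1 ->
  rho u P <= pi / 2 -> rho u Q <= pi / 2 -> rho P Q <= pi / 2 -> rho p Q <= pi / 2 ->
  rho p q <= pi / 2 -> rho P Q <= rho p q ->
  is_convex_comb mdist s u P p -> is_convex_comb mdist t u Q q ->
  rho u q <= rho u p.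
Proof.
move=> t0 ts s1 uP uQ PQ pQ pq PQpq cp cq.
have H := CAT_cos2 (_ : 0 <= s <= 1) (_ : 0 <= t <= 1) uP uQ PQ pQ cp cq.
have {}H := H ltac:(lra) ltac:(lra).
have [up _] := convex_comb_angdist (kappa := kappa) cp.
have [uq _] := convex_comb_angdist (kappa := kappa) cq.
have A0 : 0 <= rho u P by exact: angdist_ge0.
have B0 : 0 <= rho u Q by exact: angdist_ge0.
have sA0 : 0 <= s * rho u P by rewrite mulr_ge0//; lra.
rewrite up uq; have [B1|B1] := eqVneq (rho u Q) 0; first by rewrite B1 mulr0.
have {}B1 : 0 < rho u Q by rewrite lt_neqAle eq_sym B1.
have [A1|A1] := eqVneq (rho u P) 0.
  have := angdistB (kappa := kappa) u P Q; rewrite A1 sub0r normrN ger0_norm// => QPQ.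
  have := angdist_triangle (kappa := kappa) p u q.
  rewrite (angdistC p u) up uq A1 mulr0 add0r => h.
  have : 0 < (1 - t) * rho u Q by rewrite mulr_gt0//; lra.
  lra.
have {}A1 : 0 < rho u P by rewrite lt_neqAle eq_sym A1.
apply: (cone_monotone (m := rho p q) (q := rho P Q)) => //; rewrite ?A1 ?B1//.
- exact: angdistB.
- exact: angdist_ge0.
Qed.

Lemma geodesic_dist (x y : X) (c : R -> X) (r : R) :
  is_geodesic mdist x y c -> 0 <= r <= mdist x y ->
  mdist (c r) x = r /\ mdist (c r) y = mdist x y - r.
Proof.
move=> [c0 c1 cE] hr; have d0 := mdist_ge0 x y; have rd : r <= mdist x y by lra.
have h0 : 0 <= (0 : R) <= mdist x y by rewrite lexx.
have h1 : 0 <= mdist x y <= mdist x y by rewrite lexx d0.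
have := cE r 0 hr h0; have := cE r (mdist x y) hr h1.
rewrite c0 c1 subr0 distrC => -> ->.
by rewrite !ger0_norm ?subr_ge0//; lra.
Qed.

Lemma convex_comb_geodesic (t : R) (x y : X) (c : R -> X) :
  0 <= t <= 1 -> is_geodesic mdist x y c ->
  is_convex_comb mdist t x y (c (t * mdist x y)).
Proof.
move=> t01 cxy.
have td : 0 <= t * mdist x y <= mdist x y.
  by rewrite mulr_ge0 ?ler_piMl ?mdist_ge0//; lra.
have [dx dy] := geodesic_dist cxy td.
exists (c @` [set s | 0 <= s <= mdist x y]); split.
- by exists c.
- by exists (t * mdist x y).
- by rewrite dx.
- by rewrite dy; ring.
Qed.

Lemma convex_comb_exists (t : R) (x y : X) :
  0 <= t <= 1 -> rho x y < pi -> exists z, is_convex_comb mdist t x y z.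
Proof.
move=> t01 xy; have [|S [c cxy SE]] := catX.1 x y.
  by rewrite /D_ ltr_pdivlMr ?sqrtr_gt0// mulrC.
by exists (c (t * mdist x y)); exact: convex_comb_geodesic.
Qed.

(** Choosing [q] on the very geodesic that carries [p] avoids an appeal to uniqueness of
    geodesics. *)
Lemma convex_comb_reparam (s t : R) (x y p : X) :
  0 <= s <= 1 -> 0 <= t <= 1 -> is_convex_comb mdist s x y p ->
  exists2 q, is_convex_comb mdist t x y q & rho p q = `|s - t| * rho x y.
Proof.
move=> s01 t01 [S [[c cxy SE] Sp px py]]; have d0 := mdist_ge0 x y.
have td r : 0 <= r <= 1 -> 0 <= r * mdist x y <= mdist x y.
  by move=> r01; rewrite mulr_ge0 ?ler_piMl//; lra.
exists (c (t * mdist x y)); first exact: convex_comb_geodesic.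
have [c0 c1 cE] := cxy.
have -> : p = c (s * mdist x y).
  move: Sp px; rewrite SE => -[r rd <-].
  by have [-> _] := geodesic_dist cxy rd => ->.
by rewrite /angdist cE ?td// -mulrBl normrM (ger0_norm d0) mulrCA.
Qed.

Lemma convex_comb_in (C : set X) (t : R) (x y z : X) :
  geodesically_convex mdist C -> C x -> C y -> is_convex_comb mdist t x y z -> C z.
Proof. by move=> convC Cx Cy [S [Sxy Sz _ _]]; exact: (convC _ _ _ Cx Cy Sxy). Qed.

End GeodesicCones.

Lemma closed_contraction_fixpoint (R : realType) (X : completeMetricType R)
    (C : set X) (F : X -> X) (k : R) :
  closed C -> C !=set0 -> (forall x, C x -> C (F x)) -> 0 <= k < 1 ->
  (forall x y, C x -> C y -> mdist (F x) (F y) <= k * mdist x y) ->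
  exists2 z, C z & F z = z.
Proof.
move=> clC [b Cb] CF /andP[k0 k1] Fk.
pose y n := iter n F b.
have Cy n : C (y n) by elim: n => //= n /CF.
(* [K] sums the geometric series of the step lengths, hence bounds the distance from [b] to every
   iterate; starting from [y n] gains a factor [k ^+ n]. *)
set K := mdist b (F b) / (1 - k).
have K0 : 0 <= K by rewrite divr_ge0 ?mdist_ge0// subr_ge0 ltW.
have yK m : mdist b (y m) <= K.
  elim: m => [|m ih]; first by rewrite mdistxx.
  apply: (le_trans (metric_triangle _ (F b) _)).
  have -> : mdist b (F b) = (1 - k) * K by rewrite mulrC divfK// subr_eq0 gt_eqF.
  have := Fk _ _ Cb (Cy m); have := ler_wpM2l k0 ih; rewrite /=; lra.
have ynm n m : mdist (y n) (y (n + m)%N) <= k ^+ n * K.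
  elim: n => [|n ih]; first by rewrite expr0 mul1r.
  apply: (le_trans (Fk _ _ (Cy n) (Cy (n + m)%N))).
  by rewrite exprS -mulrA ler_wpM2l.
have geo (e : R) : 0 < e -> exists N, forall n, (N <= n)%N -> k ^+ n * K < e.
  move=> e0.
  have : (fun n => K * k ^+ n) @ \oo --> (0 : R).
    rewrite -[X in _ --> X](mulr0 K).
    by apply: cvgMr; apply: cvg_expr; rewrite ger0_norm.
  move=> /cvgrPdist_lt/(_ _ e0)[N _ NE]; exists N => n Nn.
  by have := NE n Nn; rewrite /= sub0r normrN mulrC ger0_norm// mulr_ge0// exprn_ge0.
have cauchy_y : cvg (y @ \oo).
  apply/cauchy_cvgP/cauchy_ballP => e e0.
  have [N NE] := geo e e0.
  exists (y @` [set n | N <= n], y @` [set n | N <= n])%N.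
    by split; exists N => // n Nn; exists n.
  move=> [_ _] [/= [n Nn <-] [m Nm <-]]; rewrite ballEmdist/=.
  have [nm|/ltnW mn] := leqP n m.
    by rewrite -(subnKC nm) (le_lt_trans (ynm _ _))// NE.
  by rewrite metric_sym -(subnKC mn) (le_lt_trans (ynm _ _))// NE.
set z := lim (y @ \oo).
have yz : y @ \oo --> z := cauchy_y.
have Cz : C z by apply: (closed_cvg _ clC _ _ yz); exact: nearW.
exists z => //; apply: esym; apply: mdist_positivity; apply/eqP.
rewrite eq_le mdist_ge0 andbT; apply/ler_addgt0Pl => e e0; rewrite addr0.
have /metricType_numDomainType.cvgrPdist_lt/(_ (e / 2)) := yz.
rewrite divr_gt0// => /(_ isT)[N _ NE].
apply: (le_trans (metric_triangle _ (y N.+1) _)).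
have := NE N (leqnn N); have := NE N.+1 (leqnSn N); rewrite /= -/z.
have := Fk _ _ (Cy N) Cz; rewrite -/(y N.+1) metric_sym.
have := ler_wpM2r (mdist_ge0 (y N) z) (ltW k1); rewrite mul1r (metric_sym z (y N)).
rewrite [F (y N)]/(y N.+1).
lra.
Qed.

(** * Elementary bounds and the Halpern step *)

Lemma cos_sub_le (R : realType) (x y e : R) :
  0 <= x -> y <= pi -> 0 <= e -> x <= y + e -> cos y - e <= cos x.
Proof.
move=> x0 ypi e0 xye; have [xy|/ltW yx] := leP x y.
  by have := ler_cos x0 xy ypi; lra.
have := cos_lipschitz y x; rewrite [leRHS]distrC [leRHS]ger0_norm ?subr_ge0// => h.
by have := ler_norm (cos y - cos x); lra.
Qed.

(** Bounding the factors by [expR (- mu n)] turns their product into the exponential of a sum, which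
    meets the logarithms in [chi] and [Tint]. It serves both for the increments of the iteration and
    for its distance to a resolvent. *)
Lemma perturbed_contraction_bound (R : realType) (s mu e : nat -> R) (P : R) (n0 : nat) :
  0 <= P -> s n0 <= P ->
  (forall n, (n0 <= n)%N -> 0 <= mu n) -> (forall n, (n0 <= n)%N -> 0 <= e n) ->
  (forall n, (n0 <= n)%N ->
    exists2 r, 0 <= r <= expR (- mu n) & s n.+1 <= r * s n + e n) ->
  forall n, s (n0 + n)%N <= P * expR (- \sum_(n0 <= i < n0 + n) mu i)
                            + \sum_(n0 <= i < n0 + n) e i.
Proof.
move=> P0 sP mu0 e0 rec; elim=> [|n ih].
  by rewrite addn0 !big_geq// oppr0 expR0 mulr1 addr0.
have le0 : (n0 <= n0 + n)%N by rewrite leq_addr.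
rewrite addnS !big_nat_recr//= opprD expRD.
have [r /andP[r0 rmu] srs] := rec _ le0; apply: (le_trans srs).
have Se0 : 0 <= \sum_(n0 <= i < n0 + n) e i.
  by rewrite big_nat_cond; apply: sumr_ge0 => i /andP[/andP[? _] _]; exact: e0.
move: ih Se0; set E := expR (- \sum_(n0 <= i < n0 + n) mu i).
set Se := \sum_(n0 <= i < n0 + n) e i => ih Se0.
have PE : 0 <= P * E by rewrite mulr_ge0// expR_ge0.
have r1 : r <= 1.
  by apply: (le_trans rmu); rewrite -expR0 ler_expR oppr_le0 mu0.
have := ler_wpM2l r0 ih; have := ler_wpM2r PE rmu; have := ler_wpM2r Se0 r1; lra.
Qed.

Lemma one_sub_le_expRN (R : realType) (x : R) : 1 - x <= expR (- x).
Proof. exact: expR_ge1Dx. Qed.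

Lemma expRN_ln_le (R : realType) (x y : R) : 0 < x -> ln x^-1 <= y -> expR (- y) <= x.
Proof.
move=> x0 h; rewrite -[leRHS]lnK ?posrE// ler_expR.
by move: h; rewrite lnV ?posrE//; lra.
Qed.

Lemma nceil_ge (R : realType) (x : R) : 0 <= x -> x <= (nceil x)%:R.
Proof.
move=> x0; rewrite /nceil natr_absz ger0_norm ?Num.Theory.ceil_ge//.
by rewrite -(ler0z R) (le_trans x0)// Num.Theory.ceil_ge.
Qed.

Lemma nceil_gt0 (R : realType) (x : R) : 0 < x -> (0 < nceil x)%N.
Proof. by move=> x0; rewrite -(ltr0n R) (lt_le_trans x0)// nceil_ge// ltW. Qed.

Lemma abs_max_ceil1_ge (R : realType) (x : R) :
  x <= (`|Num.max (Num.ceil x) 1|%N)%:R.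
Proof.
rewrite natr_absz ger0_norm; last by rewrite le_max ler01 orbT.
by apply: (le_trans (Num.Theory.ceil_ge x)); rewrite ler_int le_max lexx.
Qed.

Lemma abs_max_ceil1_gt0 (R : realType) (x : R) :
  (0 < `|Num.max (Num.ceil x) 1|%N)%N.
Proof. by rewrite absz_gt0 gt_eqF// lt_max ltr01 orbT. Qed.

Lemma leq_iter (f : nat -> nat) i j : (forall k, k <= f k)%N -> (i <= j)%N ->
  (iter i f 0 <= iter j f 0)%N.
Proof.
move=> fge; elim: j => [|j ih]; first by rewrite leqn0 => /eqP ->.
by rewrite leq_eqVlt => /predU1P[->//|/ih/leq_trans]; apply; exact: fge.
Qed.

(** If all of the first [B] steps along the orbit of 0 under [f] gained more than [eta], the
    sequence would exceed [B * eta], hence [b]. *)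
Lemma bounded_seq_metastable (R : realType) (a : nat -> R) (f : nat -> nat)
    (b eta : R) (B : nat) :
  (forall i, i <= f i)%N -> (0 < B)%N -> 0 <= a 0%N -> (forall i, a i <= b) -> b <= B%:R * eta ->
  exists2 K, (K <= iter B f 0)%N & a (f K) - a K <= eta.
Proof.
move=> fge B0 a0 ab bB.
suff [j jB hj] : exists2 j, (j < B)%N & a (f (iter j f 0%N)) - a (iter j f 0%N) <= eta.
  by exists (iter j f 0%N); rewrite ?leq_iter// ltnW.
apply: contrapT => /forall2NP H.
have {}H j : (j < B)%N -> eta < a (iter j.+1 f 0%N) - a (iter j f 0%N).
  by move=> jB; have [//|/negP] := H j; rewrite -ltNge.
have ja j : (j <= B)%N -> j%:R * eta <= a (iter j f 0%N).
  elim: j => [|j ih] jB; first by rewrite mul0r.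
  by rewrite -natr1 mulrDl mul1r; have := H j jB; have := ih (ltnW jB); lra.
case: B B0 bB H ja => // B _ bB H ja.
have := H B (leqnn _); have := ja B (leqnSn _); have := ab (iter B.+1 f 0%N).
by move: bB; rewrite -natr1 mulrDl mul1r; lra.
Qed.

(** * Resolvents and a single step of the iteration *)

Section HalpernSetting.
Context {R : realType} (kappa : R) (X : completeMetricType R).
Variables (C : set X) (T : X -> X) (b : R).
Hypotheses (kappa_gt0 : 0 < kappa) (catX : is_CAT kappa X) (b_itv : 0 < b < pi / 2).
Hypotheses (convC : geodesically_convex mdist C) (TC : forall y, C y -> C (T y)).
Hypothesis T_nonexp : nonexpansive_on C T.
Local Notation rho := (angdist kappa).
Hypothesis rhoC : forall x y, C x -> C y -> rho x y <= b.

Let rho_pihalf x y : C x -> C y -> rho x y <= pi / 2.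
Proof. by move=> Cx Cy; have := rhoC Cx Cy; have := b_itv; lra. Qed.

Let rho_T x y : C x -> C y -> rho (T x) (T y) <= rho x y.
Proof. by move=> Cx Cy; rewrite ler_wpM2l ?sqrtr_ge0// T_nonexp. Qed.

Let cosb_gt0 : 0 < cos b.
Proof. by apply: cos_gt0_pihalf; have := b_itv; lra. Qed.

Let cosb_le_cos_rho x y : C x -> C y -> cos b <= cos (rho x y).
Proof.
move=> Cx Cy; apply: ler_cos; [exact: angdist_ge0|exact: rhoC|].
by have := b_itv; have := pi_ge0 R; lra.
Qed.

Lemma resolvent_exists (t : R) (u : X) : closed C -> C u -> 0 <= t < 1 ->
  exists2 z, C z & is_convex_comb mdist t u (T z) z.
Proof.
move=> clC Cu t01; have pi0 := pi_ge0 R.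
have bi := b_itv; have cb0 := cosb_gt0.
have /choice[F FE] : forall y, exists w, C y -> is_convex_comb mdist t u (T y) w.
  move=> y; have [Cy|Cy] := pselect (C y); last by exists y.
  have [||w wE] := @convex_comb_exists _ kappa X kappa_gt0 catX t u (T y).
  - lra.
  - by have := rhoC Cu (TC Cy); lra.
  - by exists w.
have CF y : C y -> C (F y).
  by move=> Cy; exact: (convex_comb_in convC Cu (TC Cy) (FE _ Cy)).
have [||||z Cz Fz] := @closed_contraction_fixpoint R X C F (1 - (1 - t) * cos b) clC.
- by exists u.
- exact: CF.
- have : 0 < (1 - t) * cos b by rewrite mulr_gt0 ?cosb_gt0//; lra.
  have : (1 - t) * cos b <= (1 - t) * 1 by rewrite ler_wpM2l ?cos_le1//; lra.
  lra.
- move=> x y Cx Cy; rewrite -(ler_pM2l (_ : 0 < Num.sqrt kappa)) ?sqrtr_gt0//.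
  rewrite mulrCA -!/(rho _ _).
  have k0 : 0 <= 1 - (1 - t) * cos b.
    have : (1 - t) * cos b <= (1 - t) * 1 by rewrite ler_wpM2l ?cos_le1//; lra.
    lra.
  apply: le_trans (ler_wpM2l k0 (rho_T Cx Cy)).
  have := CF _ Cx; have := CF _ Cy; have := TC Cx; have := TC Cy => ? ? ? ?.
  apply: (convex_comb_contraction kappa_gt0 catX (u := u)); rewrite ?rhoC ?rho_pihalf//; try lra.
  + exact: FE.
  + exact: FE.
by exists z => //; rewrite -{2}Fz; exact: FE.
Qed.

Lemma resolvent_angdist_le (s t : R) (u p q : X) :
  C u -> C p -> C q -> 0 <= t -> t < s -> s <= 1 ->
  is_convex_comb mdist s u (T p) p -> is_convex_comb mdist t u (T q) q ->
  rho u q <= rho u p.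
Proof.
move=> Cu Cp Cq t0 ts s1 cp cq; have := TC Cp; have := TC Cq => CTq CTp.
by apply: (angdist_apex_le kappa_gt0 catX t0 ts s1) cp cq; rewrite ?rho_pihalf// rho_T.
Qed.

(** [CAT_cos] is applied at [T y] to [z] on the segment from [u] to [T z]. Nonexpansiveness replaces
    [rho (T y) (T z)] by [rho (T y) z] up to the displacement of [y], so that [cos (rho (T y) z)]
    remains with the coefficient [sin D - sin (t * D)], at most [sin ((1 - t) * D) * cos (t * D)];
    here [cos (t * D)] is [cos (rho u z)]. *)
Lemma resolvent_cos_le (t : R) (u y z : X) :
  C u -> C y -> C z -> 0 <= t <= 1 -> is_convex_comb mdist t u (T z) z ->
  (1 - t) * cos b * (cos (rho u (T y)) - cos (rho u z)) <= t * rho y (T y).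
Proof.
move=> Cu Cy Cz t01 cz; have CTy := TC Cy; have CTz := TC Cz; have pi0 := pi_ge0 R.
have bi := b_itv; have cb0 := cosb_gt0.
have e0 : 0 <= rho y (T y) by exact: angdist_ge0.
have te0 : 0 <= t * rho y (T y) by rewrite mulr_ge0//; lra.
have tc0 : 0 <= (1 - t) * cos b by rewrite mulr_ge0 ?(ltW cosb_gt0)//; lra.
have [neg|pos] := leP (cos (rho u (T y)) - cos (rho u z)) 0.
  by apply: le_trans te0; rewrite mulr_ge0_le0.
have [uz _] := convex_comb_angdist (kappa := kappa) cz.
have H : sin ((1 - t) * rho u (T z)) * cos (rho (T y) u)
    + sin (t * rho u (T z)) * cos (rho (T y) (T z))
    <= sin (rho u (T z)) * cos (rho (T y) z).
  by apply: CAT_cos; rewrite ?rho_pihalf.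
have Db := rhoC Cu CTz.
set D := rho u (T z) in uz H Db *.
have D0 : 0 <= D by exact: angdist_ge0.
have {D0}D0 : 0 < D.
  rewrite lt_neqAle D0 andbT; apply/eqP => D0'; move: pos.
  by rewrite uz -D0' mulr0 cos0; have := cos_le1 (rho u (T y)); lra.
have tD : 0 <= t * D <= D by rewrite mulr_ge0 ?ler_piMl//; lra.
have uD : 0 <= (1 - t) * D <= D by rewrite mulr_ge0 ?ler_piMl//; lra.
have cTT : cos (rho (T y) z) - rho y (T y) <= cos (rho (T y) (T z)).
  apply: cos_sub_le => //; first exact: angdist_ge0.
  - by have := rho_pihalf CTy Cz; lra.
  - apply: (le_trans (rho_T Cy Cz)); rewrite (addrC (rho (T y) z)).
    exact: angdist_triangle.
have sin_tD : 0 <= sin (t * D) <= t * D.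
  by rewrite sin_le_id ?andbT; [apply: sin_ge0_pihalf|]; lra.
have sin_uD : (1 - t) * D * cos b <= sin ((1 - t) * D).
  apply: le_trans (sin_ge_mul_cos _); last by lra.
  by rewrite ler_wpM2l//; [|apply: ler_cos]; lra.
have cTz : 0 <= cos (rho (T y) z) <= 1.
  by rewrite cos_le1 andbT (le_trans _ (cosb_le_cos_rho CTy Cz))// ltW.
have sD : sin D - sin (t * D) <= sin ((1 - t) * D) * cos (t * D).
  rewrite {1}(_ : D = (1 - t) * D + t * D); last by ring.
  rewrite sinD; have := cos_le1 ((1 - t) * D); have [s0 _] := andP sin_tD.
  by move=> /(ler_wpM2r s0); lra.
have sc0 : 0 <= sin ((1 - t) * D) * cos (t * D).
  apply: mulr_ge0; first by apply: sin_ge0_pihalf; lra.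
  by apply: cos_ge0_pihalf; lra.
have h1 : (sin D - sin (t * D)) * cos (rho (T y) z) <= sin ((1 - t) * D) * cos (t * D).
  apply: (@le_trans _ _ (sin ((1 - t) * D) * cos (t * D) * cos (rho (T y) z))).
    by rewrite ler_wpM2r//; lra.
  by rewrite -[leRHS]mulr1 ler_wpM2l//; lra.
have h2 : sin (t * D) * (cos (rho (T y) z) - rho y (T y))
    <= sin (t * D) * cos (rho (T y) (T z)) by rewrite ler_wpM2l//; lra.
have h3 : sin ((1 - t) * D) * (cos (rho u (T y)) - cos (rho u z))
    <= t * D * rho y (T y).
  have : sin (t * D) * rho y (T y) <= t * D * rho y (T y) by rewrite ler_wpM2r//; lra.
  rewrite uz (angdistC u (T y)); lra.
have h4 : (1 - t) * D * cos b * (cos (rho u (T y)) - cos (rho u z))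
    <= sin ((1 - t) * D) * (cos (rho u (T y)) - cos (rho u z)).
  by rewrite ler_wpM2r// ltW.
rewrite -(ler_pM2l D0); lra.
Qed.

(** Dividing [CAT_cos] at [z] by [sin D], for [D = rho u y], gives [y] the weight
    [r = sin ((1 - l) * D) / sin D]. In the hypothesis, [l * rho u y] pays for replacing
    [cos ((1 - l) * D)] by [cos D], and the factor [cos b] for comparing [sin (l * D)] with
    [sin D - sin ((1 - l) * D)]. *)
Lemma halpern_step_cos (l beta : R) (u y z m : X) :
  C u -> C y -> C z -> 0 <= l <= 1 -> is_convex_comb mdist (1 - l) u y m ->
  0 <= beta -> cos (rho u y) + l * rho u y - cos (rho z u) <= cos b * beta ->
  exists2 r, 0 <= r <= 1 - cos b * l &
    1 - cos (rho z m) <= r * (1 - cos (rho z y)) + (1 - r) * beta.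
Proof.
move=> Cu Cy Cz l01 cm beta0 hbeta; have pi0 := pi_ge0 R.
have bi := b_itv; have cb0 := cosb_gt0.
have cb1 : cos b <= 1 by exact: cos_le1.
have cl : 0 <= cos b * l <= 1.
  have : cos b * l <= 1 * 1 by apply: ler_pM => //; lra.
  by rewrite mul1r mulr_ge0 ?(ltW cosb_gt0)//; lra.
have [um my] := convex_comb_angdist (kappa := kappa) cm.
have eq_of_rho0 (v w : X) : rho v w = 0 -> v = w.
  move=> /eqP; rewrite mulf_eq0 gt_eqF ?sqrtr_gt0//= => /eqP.
  exact: mdist_positivity.
(* For [y = u] the quotient of sines is undefined, and the largest admissible [r] is taken. *)
have [D0|D0] := eqVneq (rho u y) 0.
  exists (1 - cos b * l); first by lra.
  move: um; rewrite D0 mulr0 => /eq_of_rho0 <-; move: (D0) => /eq_of_rho0 <-.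
  move: hbeta; rewrite D0 cos0 mulr0 addr0 => hbeta.
  have : cos b * beta <= 1 * beta by rewrite ler_wpM2r.
  have : 0 <= cos b * l * (beta - (1 - cos (rho z u))).
    have : cos b * beta <= 1 * beta by rewrite ler_wpM2r.
    by move=> ?; apply: mulr_ge0; lra.
  lra.
have Db := rhoC Cu Cy.
have H : sin ((1 - (1 - l)) * rho u y) * cos (rho z u)
    + sin ((1 - l) * rho u y) * cos (rho z y) <= sin (rho u y) * cos (rho z m).
  by apply: CAT_cos cm; rewrite ?rho_pihalf//; lra.
move: H; rewrite (_ : 1 - (1 - l) = l); last by ring.
have {D0}D0 : 0 < rho u y by rewrite lt_neqAle eq_sym D0 angdist_ge0.
move: um my hbeta Db D0; set D := rho u y => um my hbeta Db D0 H.
have lD : 0 <= l * D <= D by rewrite mulr_ge0 ?ler_piMl//; lra.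
have sinD_gt0 : 0 < sin D by apply: sin_gt0_pi; lra.
have r1 : sin ((1 - l) * D) <= (1 - cos b * l) * sin D.
  have -> : 1 - cos b * l = 1 - (1 - (1 - l)) * cos b by ring.
  by apply: sin_scale_le; lra.
have w0 : 0 <= sin (l * D) <= l * D.
  by rewrite sin_le_id ?andbT; [apply: sin_ge0_pihalf|]; lra.
have r0 : 0 <= sin ((1 - l) * D) by apply: sin_ge0_pihalf; lra.
exists (sin ((1 - l) * D) / sin D).
  by rewrite divr_ge0 ?(ltW sinD_gt0)//= ler_pdivrMr.
rewrite -(ler_pM2l sinD_gt0).
have -> (v w : R) : sin D * (sin ((1 - l) * D) / sin D * v
      + (1 - sin ((1 - l) * D) / sin D) * w)
    = sin ((1 - l) * D) * v + (sin D - sin ((1 - l) * D)) * w.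
  by field; rewrite gt_eqF.
have wS : cos b * sin (l * D) <= sin D - sin ((1 - l) * D).
  have := @sin_sub_le R D (l * D) lD ltac:(lra).
  rewrite (_ : D - l * D = (1 - l) * D); last by ring.
  have : sin (l * D) * cos b <= l * D * cos D.
    by apply: ler_pM; [lra|exact: ltW|lra|apply: ler_cos; lra].
  lra.
have Sw : sin D - sin ((1 - l) * D) <= sin (l * D) * (cos D + l * D).
  have c2 : cos ((1 - l) * D) <= cos D + l * D.
    rewrite -lerBlDr; apply: cos_sub_le; lra.
  rewrite {1}(_ : D = l * D + (1 - l) * D); last by ring.
  have c1 := cos_le1 (l * D).
  rewrite sinD; have [w0' _] := andP w0.
  by have := ler_wpM2l w0' c2; have := ler_wpM2r r0 c1; lra.
have : sin (l * D) * (cos D + l * D - cos (rho z u)) <= sin (l * D) * (cos b * beta).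
  by rewrite ler_wpM2l//; lra.
have := ler_wpM2r beta0 wS; lra.
Qed.

Lemma halpern_increment_le (l l' : R) (u x y p q : X) :
  C u -> C x -> C y -> 0 <= l <= 1 -> 0 <= l' <= 1 ->
  is_convex_comb mdist (1 - l) u (T x) p -> is_convex_comb mdist (1 - l') u (T y) q ->
  rho q p <= (1 - cos b * l') * rho y x + b * `|l' - l|.
Proof.
move=> Cu Cx Cy l01 l'01 cp cq; have CTx := TC Cx; have CTy := TC Cy.
have bi := b_itv; have cb0 := cosb_gt0.
(* [p'] has the segment of [p] and the parameter of [q]: from [q] to [p'] the cone contracts, from
   [p'] to [p] only the parameter changes. *)
have [||p' cp' pp'] := @convex_comb_reparam _ kappa X (1 - l) (1 - l') u (T x) p _ _ cp.
- lra.
- lra.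
have Cp' := convex_comb_in convC Cu CTx cp'; have Cq := convex_comb_in convC Cu CTy cq.
apply: (le_trans (angdist_triangle q p' p)); apply: lerD.
  have l'0 : 0 <= 1 - cos b * l'.
    have : cos b * l' <= 1 * 1.
      by apply: ler_pM; [exact: ltW|lra|exact: cos_le1|lra].
    lra.
  apply: le_trans (ler_wpM2l l'0 (rho_T Cy Cx)).
  have := @convex_comb_contraction R kappa X kappa_gt0 catX b (1 - l') u (T y) (T x) q p'.
  have -> : (1 - (1 - l')) * cos b = cos b * l' by ring.
  by apply; rewrite ?rhoC ?rho_pihalf//; lra.
rewrite angdistC pp' mulrC (_ : 1 - l - (1 - l') = l' - l); last by ring.
by rewrite ler_wpM2r// rhoC.
Qed.

End HalpernSetting.

(** * Asymptotic regularity *)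

Section Rates.
Context {R : realType} (lambda : nat -> R) (alpha gamma : R -> nat) (theta : nat -> nat).
Hypothesis lambda_itv : forall n, (0 < n)%N -> 0 <= lambda n <= 1.
Hypothesis rates : halpern_rates lambda alpha gamma theta.

Lemma theta_sum_ge N : (0 < N)%N ->
  N%:R <= \sum_(0 <= i < theta N) lambda i.+2.
Proof.
by move=> N0; have [_ _ /(_ N N0)] := rates; rewrite big_add1.
Qed.

Lemma lambda_sum_ge0 j n : 0 <= \sum_(j <= i < n) lambda i.+2.
Proof. by apply: sumr_ge0 => i _; have /andP[] := lambda_itv (ltn0Sn i.+1). Qed.

Lemma lambda_sum_le n : \sum_(0 <= i < n) lambda i.+2 <= n%:R.
Proof.
rewrite big_mkord -[n in leRHS]card_ord -sum1_card natr_sum.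
by apply: ler_sum => i _; have /andP[] := lambda_itv (ltn0Sn i.+1).
Qed.

Lemma theta_ge N : (0 < N)%N -> (N <= theta N)%N.
Proof.
by move=> N0; rewrite -(ler_nat R) (le_trans (theta_sum_ge N0))// lambda_sum_le.
Qed.

(** Dropping the first [j] terms, each at most 1, costs at most [j]. For [n < j] the sum is empty,
    but then [N <= theta N <= n < j]. *)
Lemma lambda_sum_tail_ge N j n : (0 < N)%N -> (theta N <= n)%N ->
  N%:R - j%:R <= \sum_(j <= i < n) lambda i.+2.
Proof.
move=> N0 thn; have [jn|nj] := leqP j n; last first.
  rewrite big_geq ?(ltnW nj)// subr_le0 ler_nat.
  by rewrite (leq_trans (theta_ge N0))// (leq_trans thn)// ltnW.
have := theta_sum_ge N0; have := lambda_sum_le j; have := lambda_sum_ge0 (theta N) n.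
have cat k : (k <= n)%N -> \sum_(0 <= i < n) lambda i.+2
    = \sum_(0 <= i < k) lambda i.+2 + \sum_(k <= i < n) lambda i.+2.
  by move=> kn; rewrite (big_cat_nat (n := k)).
have := cat _ jn; have := cat _ thn.
lra.
Qed.

Lemma theta_scaled_gt (c : R) j m n : 0 < c -> (0 < m)%N ->
  (theta (nceil c^-1 * (j + m)) <= n)%N -> (j < n)%N.
Proof.
move=> c0 m0; have k0 : (0 < nceil c^-1)%N by rewrite nceil_gt0// invr_gt0.
apply: leq_trans; apply: (@leq_trans (j + m)%N).
  by rewrite -addn1 leq_add2l.
apply: leq_trans (theta_ge _); first by rewrite leq_pmull.
by rewrite muln_gt0 k0 addn_gt0 m0 orbT.
Qed.

(** This accounts for the arguments of [theta] in [chi] and [Theta]: the factor [nceil c^-1] offsets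
    the weight [c = cos b], and the summand [j] the dropped terms. *)
Lemma theta_scaled_sum_ge (c : R) j m n : 0 < c -> (0 < m)%N ->
  (theta (nceil c^-1 * (j + m)) <= n)%N ->
  m%:R <= \sum_(j <= i < n) c * lambda i.+2.
Proof.
move=> c0 m0 thn; have k0 : (0 < nceil c^-1)%N by rewrite nceil_gt0// invr_gt0.
have N0 : (0 < nceil c^-1 * (j + m))%N by rewrite muln_gt0 k0 addn_gt0 m0 orbT.
have := lambda_sum_tail_ge j N0 thn.
have h : c^-1 * m%:R <= (nceil c^-1 * (j + m))%:R - j%:R.
  have h1 : c^-1 * m%:R <= (nceil c^-1)%:R * m%:R by rewrite ler_wpM2r// nceil_ge// invr_ge0 ltW.
  have h2 : j%:R <= (nceil c^-1)%:R * j%:R :> R by rewrite -natrM ler_nat leq_pmull.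
  rewrite natrM natrD mulrDr; lra.
move=> /(le_trans h)/(ler_wpM2l (ltW c0)).
by rewrite mulrA divff ?gt_eqF// mul1r mulr_sumr.
Qed.

End Rates.

Section HalpernRegularity.
Context {R : realType} (kappa : R) (X : completeMetricType R).
Variables (C : set X) (T : X -> X) (b : R) (u : X) (x : nat -> X).
Hypotheses (kappa_gt0 : 0 < kappa) (catX : is_CAT kappa X) (b_itv : 0 < b < pi / 2).
Hypotheses (convC : geodesically_convex mdist C) (TC : forall y, C y -> C (T y)).
Hypothesis T_nonexp : nonexpansive_on C T.
Local Notation rho := (angdist kappa).
Hypothesis rhoC : forall x y, C x -> C y -> rho x y <= b.
Variables (lambda : nat -> R) (alpha gamma : R -> nat) (theta : nat -> nat).
Hypothesis lambda_itv : forall n, (0 < n)%N -> 0 <= lambda n <= 1.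
Hypothesis rates : halpern_rates lambda alpha gamma theta.
Hypotheses (Cu : C u) (halpern : halpern_iteration T lambda u x).

Lemma halpern_in n : C (x n).
Proof.
have [x0 xS] := halpern.
by elim: n => [|n ih]; [rewrite x0|exact: (convex_comb_in convC Cu (TC ih) (xS n))].
Qed.

Let cosb_gt0 : 0 < cos b.
Proof. by apply: cos_gt0_pihalf; have := b_itv; lra. Qed.

(** Of [4 * b * L], one [b * L] comes from the decay of the increments after [gamma L], one from the
    variation of [lambda] there, and [2 * b * L] from the distance of [x n.+1] to [T (x n)]. *)
Lemma halpern_regularity (L : R) n : 0 < L ->
  (maxn (theta (nceil (cos b)^-1 *
               (gamma L + `|Num.max (Num.ceil (ln L^-1)) 1|))%N)
       (alpha (2 * L)) <= n)%N ->
  rho (x n) (T (x n)) <= 4 * b * L /\ lambda n.+1 <= 2 * L.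
Proof.
move=> L0; rewrite geq_max => /andP[]; set m := `|Num.max _ _|%N.
move=> thn aln.
have bi := b_itv; have cb0 := cosb_gt0; have [x0 xS] := halpern.
have [rate1 rate2 _] := rates.
have l2L : lambda n.+1 <= 2 * L by apply: rate1 => //; lra.
have := lambda_itv (ltn0Sn n) => ln.
have m0 : (0 < m)%N by exact: abs_max_ceil1_gt0.
have gN := theta_scaled_gt lambda_itv rates cb0 m0 thn.
set s := fun k => rho (x k.+1) (x k).
have := @perturbed_contraction_bound R s (fun k => cos b * lambda k.+2)
  (fun k => b * `|lambda k.+2 - lambda k.+1|) b (gamma L).
move=> /(_ _ _ _ _ _ (n - gamma L)%N)/wrap[]; rewrite ?subnKC ?(ltnW gN)//.
- lra.
- by apply: rhoC; exact: halpern_in.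
- move=> k _; have := lambda_itv (ltn0Sn k.+1) => ?; rewrite mulr_ge0//; lra.
- by move=> k _; rewrite mulr_ge0//; lra.
- move=> k _; exists (1 - cos b * lambda k.+2).
    rewrite one_sub_le_expRN andbT.
    have := lambda_itv (ltn0Sn k.+1) => ?.
    have : cos b * lambda k.+2 <= 1 * 1.
      by apply: ler_pM; [lra|lra|exact: cos_le1|lra].
    lra.
  apply: (halpern_increment_le kappa_gt0 catX b_itv convC TC T_nonexp rhoC Cu
    (halpern_in k) (halpern_in k.+1)) (xS k) (xS k.+1); exact: lambda_itv.
rewrite -[X in _ <= _ + X]mulr_sumr => sn.
have e2 : \sum_(gamma L <= i < n) `|lambda i.+2 - lambda i.+1| <= L.
  have := rate2 L L0 (n - gamma L)%N; rewrite subn_gt0 => /(_ gN).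
  by rewrite subnKC ?(ltnW gN)// big_add1.
have e1 : expR (- \sum_(gamma L <= i < n) cos b * lambda i.+2) <= L.
  apply: expRN_ln_le => //; apply: (le_trans (abs_max_ceil1_ge _)); rewrite -/m.
  exact: (theta_scaled_sum_ge lambda_itv rates).
have sn2 : rho (x n.+1) (x n) <= 2 * b * L.
  have := ler_wpM2l (_ : 0 <= b) e1; have := ler_wpM2l (_ : 0 <= b) e2.
  rewrite -/(s n); move=> /(_ ltac:(lra)) h1 /(_ ltac:(lra)) h2; lra.
split=> //; apply: (le_trans (angdist_triangle _ (x n.+1) _)).
rewrite (angdistC (x n)).
have [_ ->] := convex_comb_angdist (kappa := kappa) (xS n).
rewrite (_ : 1 - (1 - lambda n.+1) = lambda n.+1); last by ring.
have : lambda n.+1 * rho u (T (x n)) <= 2 * L * b.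
  by apply: ler_pM; rewrite ?angdist_ge0 ?rhoC//; [lra|exact/TC/halpern_in].
lra.
Qed.

End HalpernRegularity.

Lemma leq_bigmax_nat (F : nat -> nat) m i n : (m <= i <= n)%N ->
  (F i <= \max_(m <= j < n.+1) F j)%N.
Proof.
move=> /andP[mi n_i]; rewrite (big_cat_nat (n := i))/=; [|lia|lia].
by rewrite [X in maxn _ X]big_ltn ?ltnS// !leq_max leqnn orbT.
Qed.

(** * Convergence to the resolvents *)

Section HalpernResolvent.
Context {R : realType} (kappa : R) (X : completeMetricType R).
Variables (C : set X) (T : X -> X) (b : R) (u : X) (x : nat -> X) (lambda : nat -> R).
Hypotheses (kappa_gt0 : 0 < kappa) (catX : is_CAT kappa X) (b_itv : 0 < b < pi / 2).
Hypotheses (convC : geodesically_convex mdist C) (TC : forall y, C y -> C (T y)).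
Hypothesis T_nonexp : nonexpansive_on C T.
Local Notation rho := (angdist kappa).
Hypothesis rhoC : forall x y, C x -> C y -> rho x y <= b.
Hypothesis lambda_itv : forall n, (0 < n)%N -> 0 <= lambda n <= 1.
Hypotheses (Cu : C u) (halpern : halpern_iteration T lambda u x).

(* [y] serves to bound the distance from [u] to [T (x n)] from below, and [z] is
   the almost fixed point of [T] that the iterates approach. *)
Lemma halpern_resolvent_bound (s t d : R) (y z : X) (n0 : nat) :
  C y -> C z -> 0 <= s < 1 -> 0 <= t <= 1 -> 0 < d ->
  is_convex_comb mdist s u (T y) y -> is_convex_comb mdist t u (T z) z ->
  rho u y <= rho u z <= rho u y + 3 / 4 * (cos b * d) ->
  (forall n, (n0 <= n)%N -> rho (x n) (T (x n)) <= (1 - s) * cos b ^+ 2 * d / 6) ->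
  (forall n, (n0 <= n)%N -> lambda n.+1 * b <= cos b * d / 12) ->
  forall n, (n0 <= n)%N ->
    1 - cos (rho z (x n)) <= d
      + 2 * sin (b / 2) ^+ 2 * expR (- \sum_(n0 <= i < n) cos b * lambda i.+1)
      + (n - n0)%:R * ((1 - t) * b).
Proof.
move=> Cy Cz s01 t01 d0 cy cz /andP[yz zy] xT lb n n0n.
have bi := b_itv; have pi0 := pi_ge0 R; have [x0 xS] := halpern.
have cb0 : 0 < cos b by apply: cos_gt0_pihalf; lra.
have Cx k : C (x k) by exact: (halpern_in convC TC Cu halpern).
have cd0 : 0 < cos b * d by rewrite mulr_gt0.
have e0 : 0 <= (1 - t) * b by rewrite mulr_ge0//; lra.
have zT : rho z (T z) <= (1 - t) * b.
  have [_ ->] := convex_comb_angdist (kappa := kappa) cz.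
  by rewrite ler_wpM2l ?rhoC//; [lra|exact: TC].
(* Subtracting the level [d] absorbs the term [(1 - r) * d] of the step and leaves only the
   displacement of [z] as error. *)
have := @perturbed_contraction_bound R (fun k => 1 - cos (rho z (x k)) - d)
  (fun k => cos b * lambda k.+1) (fun=> (1 - t) * b) (2 * sin (b / 2) ^+ 2) n0.
move=> /(_ _ _ _ _ _ (n - n0)%N)/wrap[]; rewrite ?subnKC//.
- by rewrite mulr_ge0 ?sqr_ge0.
- rewrite -cos_half.
  have : cos b <= cos (rho z (x n0)).
    by apply: ler_cos; [exact: angdist_ge0|exact: rhoC|lra].
  lra.
- by move=> k _; have := lambda_itv (ltn0Sn k) => ?; rewrite mulr_ge0//; lra.
- move=> k n0k; have lk := lambda_itv (ltn0Sn k); have CTx := TC (Cx k).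
  (* [halpern_step_cos] allows [cos b * d] in total, split as 1/6 for regularity, 3/4 for passing
     from [y] to [z], and 1/12 for [lambda]. *)
  have uT : cos (rho u (T (x k))) - cos (rho u y) <= cos b * d / 6.
    have := resolvent_cos_le kappa_gt0 catX b_itv TC T_nonexp rhoC Cu (Cx k) Cy _ cy.
    move=> /(_ ltac:(lra)) h.
    have sc : 0 < (1 - s) * cos b by rewrite mulr_gt0//; lra.
    rewrite -(ler_pM2l sc); apply: (le_trans h).
    have : s * rho (x k) (T (x k)) <= 1 * rho (x k) (T (x k)).
      by rewrite ler_wpM2r ?angdist_ge0//; lra.
    by move=> /le_trans; apply; rewrite mul1r; apply: (le_trans (xT _ n0k)); lra.
  have yz' : cos (rho u y) - cos (rho z u) <= 3 / 4 * (cos b * d).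
    rewrite (angdistC z); apply: (le_trans (ler_norm _)).
    apply: (le_trans (cos_lipschitz _ _)).
    by rewrite distrC ger0_norm ?subr_ge0//; lra.
  have lu : lambda k.+1 * rho u (T (x k)) <= cos b * d / 12.
    by apply: le_trans (lb _ n0k); rewrite ler_wpM2l ?rhoC//; lra.
  have [||r r01 hr] := @halpern_step_cos R kappa X C b kappa_gt0 catX b_itv rhoC
    (lambda k.+1) d u (T (x k)) z (x k.+1) Cu CTx Cz lk (xS k).
  + exact: ltW.
  + lra.
  exists r; first by have := one_sub_le_expRN (cos b * lambda k.+1); lra.
  have [r0 r1] := andP r01.
  have cl0 : 0 <= cos b * lambda k.+1 by rewrite mulr_ge0//; lra.
  have zTx : cos (rho z (x k)) - (1 - t) * b <= cos (rho z (T (x k))).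
    apply: cos_sub_le => //; first exact: angdist_ge0.
      by have := rhoC Cz (Cx k); lra.
    apply: (le_trans (angdist_triangle _ (T z) _)); rewrite addrC lerD//.
    by rewrite ler_wpM2l ?sqrtr_ge0// T_nonexp.
  have := ler_wpM2l r0 zTx.
  have : r * ((1 - t) * b) <= 1 * ((1 - t) * b) by rewrite ler_wpM2r//; lra.
  lra.
rewrite sumr_const_nat -mulr_natl; lra.
Qed.

End HalpernResolvent.

(** * The functionals of the bound and the threshold [eps0] *)

Lemma Theta_le_Afun (R : realType) (eps kappa M : R) (alpha gamma : R -> nat)
    (theta : nat -> nat) (K n : nat) :
  0 < cos (M * Num.sqrt kappa) ->
  (nceil (eps0 eps kappa M)^-1 <= K <= n)%N ->
  (Theta kappa M theta alpha gamma K (sin2eps eps kappa)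
    <= Afun eps kappa M theta alpha gamma n)%N.
Proof.
move=> c0 Kn; rewrite /Theta /Afun ltnS.
have -> : Sint eps kappa M = Tint kappa M (sin2eps eps kappa).
  by rewrite /Sint /Tint mulrAC.
have c'0 : (0 < nceil (cos (M * Num.sqrt kappa))^-1)%N by rewrite nceil_gt0// invr_gt0.
(* Monotonicity of [theta] and of [chi_star] in the index is not assumed; the maxima in [theta_plus]
   and [Gamma] stand in for it. *)
apply: (@leq_bigmax_nat theta).
rewrite muln_gt0 c'0/= addn_gt0 abs_max_ceil1_gt0 orbT/= leq_mul2l leq_add2r leq_sub2r ?orbT//.
rewrite [sin2eps _ _ / 3]mulrC.
exact: (@leq_bigmax_nat (fun i => chi_star kappa M theta alpha gamma i _)).
Qed.

Lemma leq_f_tilde (R : realType) (eps : R) g (kappa M : R) theta (alpha gamma : R -> nat) i :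
  (i <= f_tilde eps g kappa M theta alpha gamma i)%N.
Proof. exact: leq_addr. Qed.

(** In this form the step is the choice of J after K: one entry brings the displacement of z_J below
    [Delta_star], the other puts J beyond K. *)
Lemma f_tildeE (R : realType) (eps : R) g (kappa M : R) theta (alpha gamma : R -> nat) i :
  let K := (i + nceil (eps0 eps kappa M)^-1)%N in
  f_tilde eps g kappa M theta alpha gamma i =
  maxn (nceil (M * Num.sqrt kappa /
               Delta_star g kappa M theta alpha gamma K (sin2eps eps kappa))) K.
Proof.
by rewrite /f_tilde /f_star addnCA /f_fun subnK// leq_maxr.
Qed.

Lemma ratio_succC (R : realType) k : 1 - k%:R / k.+1%:R = k.+1%:R^-1 :> R.
Proof. by rewrite -natr1; field; rewrite natr1 pnatr_eq0. Qed.

Lemma ratio_succ_lt (R : realType) i j :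
  (i < j)%N -> i%:R / i.+1%:R < j%:R / j.+1%:R :> R.
Proof.
move=> ij; rewrite -ltrN2 -(ltrD2l 1) !ratio_succC.
by rewrite ltf_pV2 ?posrE ?ltr0n// ltr_nat ltnS.
Qed.

(** [1 - cos eps0] is at most quadratic in [cos b * d], and one factor is absorbed through
    [cos b * d <= d <= b <= tan b]. *)
Lemma eps0_threshold (R : realType) (b d : R) :
  0 < b < pi / 2 -> 0 < d -> d <= b ^+ 2 / 16 ->
  (1 - cos (cos b / 36 * d)) / tan b <= 3 / 4 * (cos b * d).
Proof.
move=> bi d0 db; have pi2 := pihalf_lt2 R; have pi0 := pi_ge0 R.
have cb0 : 0 < cos b by apply: cos_gt0_pihalf; lra.
have cb1 := cos_le1 b.
have cd0 : 0 < cos b * d by rewrite mulr_gt0.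
have btan : b <= tan b.
  by rewrite /tan ler_pdivlMr//; apply: sin_ge_mul_cos; lra.
rewrite ler_pdivrMr; last by lra.
have h0 : 0 <= cos b / 36 * d by lra.
apply: (le_trans (one_sub_cos_le h0)).
have : cos b * d * b <= cos b * d * tan b by rewrite ler_wpM2l//; lra.
have : cos b * d * (cos b * d) <= cos b * d * b.
  rewrite ler_wpM2l//; first by lra.
  have : cos b * d <= 1 * d by rewrite ler_wpM2r//; lra.
  have : b * b <= b * 2 by rewrite ler_wpM2l//; lra.
  rewrite expr2 in db; lra.
have : 0 <= cos b * d * tan b by rewrite mulr_ge0//; lra.
rewrite expr2; lra.
Qed.

(** * Metastability *)

Section HalpernWindow.
Context {R : realType} (kappa : R) (X : completeMetricType R).
Variables (C : set X) (T : X -> X) (M b : R) (u : X) (x : nat -> X).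
Hypotheses (kappa_gt0 : 0 < kappa) (catX : is_CAT kappa X).
Hypotheses (bE : b = M * Num.sqrt kappa) (b_itv : 0 < b < pi / 2).
Hypotheses (convC : geodesically_convex mdist C) (TC : forall y, C y -> C (T y)).
Hypothesis T_nonexp : nonexpansive_on C T.
Local Notation rho := (angdist kappa).
Hypothesis rhoC : forall x y, C x -> C y -> rho x y <= b.
Variables (lambda : nat -> R) (alpha gamma : R -> nat) (theta : nat -> nat).
Hypothesis lambda_itv : forall n, (0 < n)%N -> 0 <= lambda n <= 1.
Hypothesis alpha_gt0 : forall eps : R, 0 < eps -> (0 < alpha eps)%N.
Hypothesis rates : halpern_rates lambda alpha gamma theta.
Hypotheses (Cu : C u) (halpern : halpern_iteration T lambda u x).

Let cosb_gt0 : 0 < cos b.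
Proof. by apply: cos_gt0_pihalf; have := b_itv; lra. Qed.

Lemma L_fun_gt0 i (d : R) : 0 < d -> 0 < L_fun kappa M i d.
Proof.
have bi := b_itv; have cb0 := cosb_gt0.
by move=> d0; rewrite /L_fun -bE divr_gt0// !mulr_gt0//; lra.
Qed.

Lemma chi_star_gt0 i (d : R) : 0 < d -> (0 < chi_star kappa M theta alpha gamma i d)%N.
Proof.
move=> d0; have cb0 := cosb_gt0; rewrite /chi_star /chi -bE leq_max alpha_gt0 ?orbT//.
by rewrite mulr_gt0// L_fun_gt0// mulr_gt0// divr_gt0.
Qed.

Lemma halpern_chi_star i (d : R) n : 0 < d ->
  (chi_star kappa M theta alpha gamma i (d / 3) <= n)%N ->
  rho (x n) (T (x n)) <= i.+1%:R^-1 * cos b ^+ 2 * d / 6 /\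
  lambda n.+1 * b <= cos b * d / 12.
Proof.
move=> d0; have cb0 := cosb_gt0; have bi := b_itv.
rewrite /chi_star /chi -bE; set L := L_fun _ _ _ _ => hn.
have L0 : 0 < L by rewrite L_fun_gt0// mulr_gt0// !divr_gt0.
have [reg lam] := halpern_regularity kappa_gt0 catX b_itv convC TC T_nonexp rhoC
  lambda_itv rates Cu halpern L0 hn.
(* The 24 is 3 from [d / 3], 2 from [chi_star] and 4 from [L_fun]; hence [4 * b * L] is exactly the
   required regularity. *)
have bL : b * L = i.+1%:R^-1 * (cos b ^+ 2 * d / 24).
  have b0 : b != 0 by rewrite gt_eqF//; lra.
  have i0 : i.+1%:R != 0 :> R by rewrite pnatr_eq0.
  rewrite /L /L_fun -bE; move: (i.+1%:R) i0 => q q0.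
  by field; rewrite q0 b0.
have q1 : i.+1%:R^-1 <= 1 :> R by rewrite invf_le1// ler1n.
move: (i.+1%:R^-1) q1 bL => q q1 bL.
split; first by apply: (le_trans reg); rewrite -mulrA bL; lra.
have : lambda n.+1 * b <= 2 * L * b by rewrite ler_wpM2r//; lra.
have : q * (cos b ^+ 2 * d / 24) <= 1 * (cos b ^+ 2 * d / 24).
  by rewrite ler_wpM2r// divr_ge0// mulr_ge0 ?sqr_ge0// ltW.
have : cos b * (cos b * d) <= 1 * (cos b * d).
  by rewrite ler_wpM2r ?cos_le1// mulr_ge0// ltW.
rewrite -bL expr2; lra.
Qed.

Lemma chi_star_lt_Theta i (d : R) : 0 < d ->
  (chi_star kappa M theta alpha gamma i (d / 3) < Theta kappa M theta alpha gamma i d)%N.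
Proof.
move=> d0; have n0 : (0 < chi_star kappa M theta alpha gamma i (d / 3))%N.
  by apply: chi_star_gt0; rewrite divr_gt0.
rewrite /Theta -bE ltnS -[X in (X <= _)%N](prednK n0) -[X in (X < _)%N]subn1.
exact: (theta_scaled_gt lambda_itv rates cosb_gt0 (abs_max_ceil1_gt0 _) (leqnn _)).
Qed.

Lemma Theta_decay i (d : R) n : 0 < d -> (Theta kappa M theta alpha gamma i d <= n)%N ->
  2 * sin (b / 2) ^+ 2 *
    expR (- \sum_(chi_star kappa M theta alpha gamma i (d / 3) <= k < n) cos b * lambda k.+1)
  <= 2 / 3 * d.
Proof.
move=> d0; set n0 := chi_star _ _ _ _ _ _ _ => Nn.
have n0_gt0 : (0 < n0)%N by apply: chi_star_gt0; rewrite divr_gt0.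
have bi := b_itv; have pi0 := pi_ge0 R.
have sb0 : 0 < sin (b / 2) by apply: sin_gt0_pi; lra.
have s2 : 0 < sin (b / 2) ^+ 2 by rewrite exprn_gt0.
have : expR (- \sum_(n0 <= k < n) cos b * lambda k.+1) <= (3 / d * sin (b / 2) ^+ 2)^-1.
  apply: expRN_ln_le; first by rewrite invr_gt0 mulr_gt0// divr_gt0.
  rewrite invrK; apply: (le_trans (abs_max_ceil1_ge _)).
  (* Lowering both ends of the sum by 1 turns [lambda k.+1] into the [lambda i.+2] controlled by
     [theta]; hence [chi_star - 1] inside [Theta] and the successor outside. *)
  move: Nn; rewrite /Theta -/n0 /Tint -bE -(prednK n0_gt0); case: n => // n.
  rewrite ltnS big_add1 subn1 /=.
  exact: (theta_scaled_sum_ge lambda_itv rates cosb_gt0 (abs_max_ceil1_gt0 _)).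
move=> /(ler_wpM2l (ltW s2)) h.
have -> : 2 / 3 * d = 2 * (sin (b / 2) ^+ 2 * (3 / d * sin (b / 2) ^+ 2)^-1).
  by field; rewrite !gt_eqF.
by rewrite -mulrA ler_wpM2l.
Qed.

(** [Delta_star] is [d / 3] divided by the number of steps from [chi_star] to the end of the window,
    so errors of that size add up to at most [d / 3]. *)
Lemma Delta_star_error (g : nat -> nat) i (d e : R) n : 0 < d ->
  b / Delta_star g kappa M theta alpha gamma i d <= e ->
  let N := Theta kappa M theta alpha gamma i d in (N <= n <= N + g N)%N ->
  (n - chi_star kappa M theta alpha gamma i (d / 3))%:R * (e^-1 * b) <= d / 3.
Proof.
move=> d0; have := chi_star_lt_Theta i d0; rewrite /Delta_star.
set n0 := chi_star _ _ _ _ _ _ _; set N := Theta _ _ _ _ _ _ _ => n0N be /= /andP[Nn nN].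
have bi := b_itv; pose W : R := N%:R - n0%:R + (g N)%:R.
have W0 : 0 < W.
  have : n0%:R < N%:R :> R by rewrite ltr_nat.
  by have := ler0n R (g N); rewrite /W; lra.
move: be; rewrite (_ : _ - _ + _ = 3 * W); last by rewrite /W; ring.
have D0 : 0 < d / (3 * W) by rewrite divr_gt0// mulr_gt0.
move=> be; have e0 : 0 < e by apply: lt_le_trans be; rewrite divr_gt0//; lra.
have eb : e^-1 * b <= d / (3 * W) by rewrite mulrC ler_pdivrMr// mulrC -ler_pdivrMr.
have nW : (n - n0)%:R <= W.
  rewrite natrB ?(leq_trans (ltnW n0N))// /W.
  have : n%:R <= N%:R + (g N)%:R :> R by rewrite -natrD ler_nat.
  lra.
apply: (@le_trans _ _ (W * (d / (3 * W)))).
  by apply: ler_pM => //; apply: mulr_ge0; [rewrite invr_ge0 ltW|lra].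
by rewrite (_ : W * _ = d / 3)//; field; rewrite gt_eqF.
Qed.

(** The bound [2 * d] is [d] for the level of the recursion, [2 / 3 * d] for the remainder of the
    initial value and [d / 3] for the accumulated displacement of [z]. *)
Lemma halpern_window (g : nat -> nat) (d : R) (K J : nat) (y z : X) :
  C y -> C z -> 0 < d ->
  is_convex_comb mdist (K%:R / K.+1%:R) u (T y) y ->
  is_convex_comb mdist (J%:R / J.+1%:R) u (T z) z ->
  rho u y <= rho u z <= rho u y + 3 / 4 * (cos b * d) ->
  b / Delta_star g kappa M theta alpha gamma K d <= J.+1%:R ->
  let N := Theta kappa M theta alpha gamma K d in
  forall n, (N <= n <= N + g N)%N -> 1 - cos (rho z (x n)) <= 2 * d.
Proof.
move=> Cy Cz d0 cy cz yz bJ N n Nn.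
have decay := Theta_decay d0 (proj1 (andP Nn)).
have error := Delta_star_error d0 bJ Nn.
have n0n := leq_trans (ltnW (chi_star_lt_Theta K d0)) (proj1 (andP Nn)).
have := halpern_resolvent_bound kappa_gt0 catX b_itv convC TC T_nonexp rhoC lambda_itv
  Cu halpern Cy Cz _ _ d0 cy cz yz _ _ n0n.
rewrite !ratio_succC => /(_ _ _ _ _)/wrap[].
- by rewrite divr_ge0//= ltr_pdivrMr// mul1r ltr_nat.
- by rewrite divr_ge0//= ler_pdivrMr// mul1r ler_nat.
- by move=> k /(halpern_chi_star d0)[].
- by move=> k /(halpern_chi_star d0)[].
move=> h; apply: (le_trans h).
by rewrite -addrA (le_trans (lerD (lexx d) (lerD decay error)))//; lra.
Qed.

End HalpernWindow.

Theorem theorem3p4 (R : realType) (kappa : R) (X : completeMetricType R)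
    (C : set X) (T : X -> X) (M : R)
    (lambda : nat -> R) (alpha gamma : R -> nat) (theta : nat -> nat)
    (u : X) (x : nat -> X) :
  0 < kappa ->
  is_CAT kappa X ->
  closed C ->
  geodesically_convex mdist C ->
  (forall y, C y -> C (T y)) ->
  nonexpansive_on C T ->
  0 < M < D_ kappa / 2 ->
  (diameter mdist C <= M%:E)%E ->
  (forall n, (0 < n)%N -> 0 <= lambda n <= 1) ->
  (forall eps : R, 0 < eps -> (0 < alpha eps)%N) ->
  (forall eps : R, 0 < eps -> (0 < gamma eps)%N) ->
  (forall n, (0 < n)%N -> (0 < theta n)%N) ->
  halpern_rates lambda alpha gamma theta ->
  C u ->
  halpern_iteration T lambda u x ->
  forall (eps : R) (g : nat -> nat),
  0 < eps < 2 ->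
  sin (eps * Num.sqrt kappa / 4) != 0 ->
  exists N K0 : nat,
    [/\ N = Theta kappa M theta alpha gamma K0
              (sin (eps * Num.sqrt kappa / 4) ^+ 2),
        (nceil (eps0 eps kappa M)^-1 <= K0
          <= iter (Bnum eps kappa M) (f_tilde eps g kappa M theta alpha gamma) 0
             + nceil (eps0 eps kappa M)^-1)%N,
        (N <= Sigma eps g kappa M theta alpha gamma)%N &
        forall m n : nat, (N <= m <= N + g N)%N -> (N <= n <= N + g N)%N ->
          mdist (x n) (x m) <= eps].
Proof.
move=> kappa0 catX clC convC TC Tne /andP[M0 MD] diamC litv al0 _ _ rates Cu halp eps g
  /andP[e0 _] sin_neq0.
have sk0 : 0 < Num.sqrt kappa by rewrite sqrtr_gt0.
have Cx k : C (x k) by exact: (halpern_in convC TC Cu halp).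
have distC y z : C y -> C z -> mdist y z <= M.
  move=> Cy Cz; rewrite -lee_fin; apply: le_trans diamC.
  by apply: ereal_sup_ubound; exists (y, z).
set b := M * Num.sqrt kappa.
have bi : 0 < b < pi / 2.
  rewrite mulr_gt0//=; move: MD; rewrite /D_ mulrAC ltr_pdivlMr//.
have pi0 := pi_ge0 R; have pige2 := pi_ge2 R.
have cb0 : 0 < cos b by apply: cos_gt0_pihalf; lra.
have d0 : 0 < sin2eps eps kappa by rewrite /sin2eps exprn_even_gt0.
rewrite -/(sin2eps eps kappa).
suff [K0 [hK0 H]] : exists K0 : nat,
    (nceil (eps0 eps kappa M)^-1 <= K0
          <= iter (Bnum eps kappa M) (f_tilde eps g kappa M theta alpha gamma) 0
             + nceil (eps0 eps kappa M)^-1)%N /\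
    let N := Theta kappa M theta alpha gamma K0 (sin2eps eps kappa) in
    forall m n : nat, (N <= m <= N + g N)%N -> (N <= n <= N + g N)%N ->
          mdist (x n) (x m) <= eps.
  exists (Theta kappa M theta alpha gamma K0 (sin2eps eps kappa)), K0; split=> //.
  exact: Theta_le_Afun.
set N0 := nceil (eps0 eps kappa M)^-1.
(* For [M <= eps] every window works. Otherwise [eps * sqrt kappa < b], which yields the bound
   [d <= b ^+ 2 / 16] needed for [eps0_threshold]. *)
have [Meps|epsM] := leP M eps.
  exists N0; split; first by rewrite leqnn leq_addl.
  by move=> N m n _ _; rewrite (le_trans _ Meps)// distC.
set d := sin2eps eps kappa in d0 *; set ft := f_tilde _ _ _ _ _ _ _.
have rhoC y z : C y -> C z -> angdist kappa y z <= b.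
  by move=> Cy Cz; rewrite /angdist /b mulrC ler_wpM2r ?distC// ltW.
have eb : 0 < eps * Num.sqrt kappa < b.
  by rewrite mulr_gt0//= /b ltr_pM2r.
have s4 : 0 <= sin (eps * Num.sqrt kappa / 4) <= eps * Num.sqrt kappa / 4.
  rewrite sin_le_id ?andbT; [apply: sin_ge0_pihalf|]; lra.
have db : d <= b ^+ 2 / 16.
  rewrite /d /sin2eps.
  have : sin (eps * Num.sqrt kappa / 4) ^+ 2 <= (b / 4) ^+ 2.
    by rewrite lerXn2r ?nnegrE//; lra.
  by rewrite expr_div_n; lra.
have /choice[z zE] : forall i : nat, exists y, C y /\
    is_convex_comb mdist (i%:R / i.+1%:R) u (T y) y.
  move=> i.
  have [|y Cy yE] := resolvent_exists kappa0 catX bi convC TC Tne rhoC (t := i%:R / i.+1%:R) clC Cu.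
    by rewrite divr_ge0//= ltr_pdivrMr// mul1r ltr_nat.
  by exists y.
pose a i := angdist kappa u (z i).
have a_mono i j : (i <= j)%N -> a i <= a j.
  rewrite leq_eqVlt => /predU1P[->//|ij]; have [Ci iE] := zE i; have [Cj jE] := zE j.
  apply: (resolvent_angdist_le kappa0 catX bi TC Tne rhoC Cu Cj Ci _ _ _ jE iE).
  - by rewrite divr_ge0.
  - exact: ratio_succ_lt.
  - by rewrite ler_pdivrMr// mul1r ler_nat.
(* [Bnum] is the ceiling of [b / eta], as [bounded_seq_metastable] requires. *)
set eta := (1 - cos (cos b / 36 * d)) / tan b.
have tanb0 : 0 < tan b.
  by rewrite /tan divr_gt0//; apply: sin_gt0_pi; lra.
have cd0 : 0 < cos b / 36 * d by rewrite mulr_gt0// divr_gt0.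
have d1 : d <= 1.
  by rewrite /d /sin2eps sin2cos2; have := sqr_ge0 (cos (eps * Num.sqrt kappa / 4)); lra.
have cos_eps0 : 0 < 1 - cos (cos b / 36 * d).
  have cd1 : cos b * d <= 1 * 1.
    by apply: ler_pM; [lra|lra|exact: cos_le1|].
  rewrite subr_gt0 -[X in _ < X]cos0 ltr_cos// in_itv/=; lra.
have bt0 : 0 < b * tan b / (1 - cos (cos b / 36 * d)).
  by apply: divr_gt0 => //; apply: mulr_gt0 => //; lra.
have bB : b * tan b / (1 - cos (cos b / 36 * d)) <= (Bnum eps kappa M)%:R.
  exact/nceil_ge/ltW.
have [|||||K1 K1B hK1] := @bounded_seq_metastable R a ft b eta (Bnum eps kappa M).
- exact: leq_f_tilde.
- exact: nceil_gt0 bt0.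
- exact: angdist_ge0.
- by move=> i; apply: rhoC => //; have [] := zE i.
- rewrite /eta mulrA ler_pdivlMr//.
  by move: bB; rewrite ler_pdivrMr.
exists (K1 + N0)%N; split; first by rewrite leq_addl leq_add2r.
have [CzK zKE] := zE (K1 + N0)%N; have [CzJ zJE] := zE (ft K1).
have ftE : ft K1 = maxn (nceil (b / Delta_star g kappa M theta alpha gamma (K1 + N0)%N d))
    (K1 + N0)%N by exact: f_tildeE.
(* The small gain is known from [K1] on; monotonicity passes it to the later start [K1 + N0]. *)
have aJ : a (K1 + N0)%N <= a (ft K1) <= a (K1 + N0)%N + 3 / 4 * (cos b * d).
  rewrite a_mono ?ftE ?leq_maxr//= -ftE.
  by have := a_mono K1 _ (leq_addr N0 _); have := eps0_threshold bi d0 db; rewrite -/eta; lra.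
have bJ : b / Delta_star g kappa M theta alpha gamma (K1 + N0)%N d <= (ft K1).+1%:R.
  have [D0|D0] := leP (b / Delta_star g kappa M theta alpha gamma (K1 + N0)%N d) 0.
    exact: le_trans D0 _.
  by apply: (le_trans (nceil_ge (ltW D0))); rewrite ler_nat ftE ltnW// ltnS leq_maxl.
have close := halpern_window kappa0 catX (erefl b) bi convC TC Tne rhoC litv al0 rates
  Cu halp CzK CzJ d0 zKE zJE aJ bJ.
move: (Theta _ _ _ _ _ _ _) close => N close.
(* [2 * d] is [1 - cos] of half of [eps * sqrt kappa], so the iterates of the window lie within
   [eps / 2] of z_J. *)
have {}close n : (N <= n <= N + g N)%N ->
    angdist kappa (z (ft K1)) (x n) <= eps * Num.sqrt kappa / 2.
  move=> /close; have := rhoC _ _ CzJ (Cx n).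
  have := angdist_ge0 (kappa := kappa) (z (ft K1)) (x n).
  set r := angdist _ _ _; rewrite cos_half ler_pM2l// /d /sin2eps => r0 rb.
  rewrite ler_sqr ?nnegrE; first last.
  - lra.
  - by apply: sin_ge0_pihalf; lra.
  by rewrite ler_sin_pihalf; lra.
move=> N' m n hm hn; rewrite -(ler_pM2l sk0) -/(angdist kappa _ _) [leRHS]mulrC.
have := close _ hm; have := close _ hn.
have := angdist_triangle (kappa := kappa) (x n) (z (ft K1)) (x m).
rewrite (angdistC (x n) (z _)); lra.
Qed.
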